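(* Assume that $K:[0,\infty)\to\mathbb{R}\cup\{\infty\}$ satisfies the following hypotheses, where the interaction potential on $\mathbb{H}^n\times\mathbb{H}^n$ is $K(x,y)=K(d(x,y))$: 1. $K$ is bounded from below by a finite constant $K_{min}<0$. 2. $K$ is locally integrable, i.e. $\int_{d(x,v)<R}|K(d(x,v))|\,dx<\infty$ for any $R>0$. 3. The limit $K_\infty=\lim_{\theta\to\infty}K(\theta)$ exists and $K$ is unstable, i.e. there exists $\rho\in\mathcal{P}(\mathbb{H}^n)$ such that $E[\rho]<\frac12K_\infty$. 4. $K$ is lower semi-continuous. 5. There exists $R_6>0$ such that $K$ is strictly increasing on $[R_6,\infty)$. Then there exists a global minimizer $\rho\in\mathcal{P}(\mathbb{H}^n)$ of the energy $$E[\rho]=\frac12\iint_{\mathbb{H}^n\times\mathbb{H}^n}K(d(x,y))\,d\rho(x)\,d\rho(y).$$ In addition, there exists $D>0$ (depending only on $K$ and the dimension $n$) such that every minimizer of $E$ has compact support with diameter at most $D$.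
   Context: Hyperboloid model: $\mathbb{H}^n=\{x\in\mathbb{R}^{n+1}: -x_0^2+x_1^2+\dots+x_n^2=-1,\ x_0>0\}$, geodesic distance $d(x,y)=\cosh^{-1}(x_0y_0-x_1y_1-\cdots-x_ny_n)$, vertex $v=(1,0,\dots,0)$, canonical volume measure $dx$. $\mathcal{P}(\mathbb{H}^n)$ is the set of Borel probability measures on $\mathbb{H}^n$; $E:\mathcal{P}(\mathbb{H}^n)\to\mathbb{R}\cup\{\infty\}$. *)

(* Defs.v *)
From HB Require Import structures.
From mathcomp Require Import all_boot all_order all_algebra.
From mathcomp Require Import all_classical all_reals all_analysis.
From mathcomp Require Import measurable_realfun.
From mathcomp Require Import ring lra.

Set Implicit Arguments.
Unset Strict Implicit.
Unset Printing Implicit Defensive.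

Import Order.TTheory GRing.Theory Num.Theory.
Import numFieldNormedType.Exports.

Local Open Scope classical_set_scope.
Local Open Scope ring_scope.

Definition cosh {R : realType} (t : R) : R := (expR t + expR (- t)) / 2.

(* The inverse of cosh : [0, +oo[ -> [1, +oo[, see the next three lemmas. *)
Definition arcosh {R : realType} (u : R) : R := ln (u + Num.sqrt (u ^+ 2 - 1)).

Lemma arcosh_ge0 {R : realType} (u : R) : 1 <= u -> 0 <= arcosh u.
Proof. by move=> u1; apply: ln_ge0; rewrite ler_wpDr// sqrtr_ge0. Qed.

Lemma arcoshK {R : realType} (u : R) : 1 <= u -> cosh (arcosh u) = u.
Proof.
move=> u1; have s0 := sqrtr_ge0 (u ^+ 2 - 1).
have sE : Num.sqrt (u ^+ 2 - 1) ^+ 2 = u ^+ 2 - 1.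
  by rewrite sqr_sqrtr// subr_ge0 exprn_ege1.
rewrite /cosh /arcosh; set s := Num.sqrt _ in s0 sE *.
have us0 : u + s != 0 by rewrite gt_eqF//; lra.
rewrite expRN lnK ?posrE; last by lra.
have -> : (u + s + (u + s)^-1) / 2 = ((u + s) ^+ 2 + 1) / (2 * (u + s)).
  by field.
have -> : (u + s) ^+ 2 + 1 = u ^+ 2 + 2 * u * s + s ^+ 2 + 1 by ring.
by rewrite sE; field.
Qed.

Lemma coshK {R : realType} (t : R) : 0 <= t -> arcosh (cosh t) = t.
Proof.
move=> t0; rewrite /arcosh /cosh expRN.
set e := expR t; have e1 : 1 <= e by rewrite -expR0 ler_expR.
have e0 : e != 0 by rewrite gt_eqF//; lra.
have ei : e^-1 <= 1 by rewrite invf_le1//; lra.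
have -> : ((e + e^-1) / 2) ^+ 2 - 1 = ((e - e^-1) / 2) ^+ 2 by field.
rewrite sqrtr_sqr ger0_norm; last by lra.
have -> : (e + e^-1) / 2 + (e - e^-1) / 2 = e by field.
by rewrite /e expRK.
Qed.

Definition hyperboloid (R : realType) (n : nat) : set 'rV[R]_n.+1 :=
  [set x | - x ord0 ord0 ^+ 2 + \sum_(i < n) x ord0 (lift ord0 i) ^+ 2 = -1 /\
           0 < x ord0 ord0].

(* H^n as a type, with the topology induced by R^(n+1). *)
Definition Hyp (R : realType) (n : nat) : Type := set_type (@hyperboloid R n).

HB.instance Definition _ (R : realType) (n : nat) :=
  Topological.copy (Hyp R n) (set_type (@hyperboloid R n)).

Lemma vertex_subproof (R : realType) (n : nat) :
  (delta_mx ord0 ord0 : 'rV[R]_n.+1) \in @hyperboloid R n.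
Proof.
rewrite inE /hyperboloid /= mxE /= expr1n big1 ?addr0 ?ltr01// => i _.
by rewrite mxE /= expr0n.
Qed.

Definition vertex (R : realType) (n : nat) : Hyp R n :=
 SigSub (vertex_subproof R n).

HB.instance Definition _ (R : realType) (n : nat) :=
  isPointed.Build (Hyp R n) (vertex R n).

HB.instance Definition _ (R : realType) (n : nat) :=
  Measurable.copy (Hyp R n) (g_sigma_algebraType (@open (Hyp R n))).

Definition hdist {R : realType} {n : nat} (x y : Hyp R n) : R :=
  arcosh (\val x ord0 ord0 * \val y ord0 ord0 -
          \sum_(i < n) \val x ord0 (lift ord0 i) * \val y ord0 (lift ord0 i)).

Definition hdiam {R : realType} {n : nat} (A : set (Hyp R n)) : \bar R :=
  ereal_sup [set (hdist p.1 p.2)%:E | p in A `*` A].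

(* Lebesgue measure on R^n, points of R^n being n-tuples. *)
Fixpoint lebesgue_tuple {R : realType} (n : nat) :
    set (n.-tuple (measurableTypeR R)) -> \bar R :=
  match n with
  | 0 => dirac ([tuple] : 0.-tuple (measurableTypeR R))
  | m.+1 => pushforward (@lebesgue_measure R \x @lebesgue_tuple R m)%E
              (fun p : measurableTypeR R * m.-tuple (measurableTypeR R) =>
                 [tuple of p.1 :: p.2])
  end.
Arguments lebesgue_tuple {R} n _.

(* The instance of lebesgue_integral_fubini for sigma-finite measures is
   overridden there by the one for subprobabilities. *)
Lemma sigma_finite_prod d1 d2 (T1 : measurableType d1) (T2 : measurableType d2)
    (R : realType) (m1 : {sigma_finite_measure set T1 -> \bar R})
    (m2 : {sigma_finite_measure set T2 -> \bar R}) :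
  sigma_finite setT (m1 \x m2)%E.
Proof.
have /sigma_finiteP[F [TF ndF Foo]] := sigma_finiteT m1.
have /sigma_finiteP[G [TG ndG Goo]] := sigma_finiteT m2.
exists (fun n => F n `*` G n).
  rewrite -setXTT TF TG predeqE => -[x y]; split.
    move=> [/= [n _ Fnx] [k _ Gky]]; exists (maxn n k) => //; split.
    - by move: x Fnx; exact/subsetPset/ndF/leq_maxl.
    - by move: y Gky; exact/subsetPset/ndG/leq_maxr.
  by move=> [n _ []/= ? ?]; split; exists n.
move=> k; have [? ?] := Foo k; have [? ?] := Goo k.
split; first exact: measurableX.
by rewrite product_measure1E// lte_mul_pinfty// ge0_fin_numE.
Qed.

Section pushforward_sigma_finite.
Context d1 d2 (T1 : measurableType d1) (T2 : measurableType d2) (R : realType).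
Variables (m : {measure set T1 -> \bar R}).
Variables (f : T1 -> T2) (g : T2 -> T1).
Hypothesis sm : sigma_finite setT m.
Hypotheses (mf : measurable_fun setT f) (mg : measurable_fun setT g).
Hypothesis fK : cancel f g.

Let nu := pushforward m f.

Let nu0 : nu set0 = 0%E. Proof. exact: measure0. Qed.

Let nu_ge0 A : (0 <= nu A)%E. Proof. exact: measure_ge0. Qed.

Let nu_sigma_additive : semi_sigma_additive nu.
Proof. exact: measure_semi_sigma_additive. Qed.

HB.instance Definition _ := isMeasure.Build _ _ _ nu
  nu0 nu_ge0 nu_sigma_additive.

Let nu_sigma_finite : sigma_finite setT nu.
Proof.
have [F FT FP] := sm.
exists (fun k => g @^-1` F k).
  by rewrite -preimage_bigcup -FT preimage_setT.
move=> k; have [mFk Fk] := FP k; split.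
  by rewrite -[X in measurable X]setTI; exact: mg.
rewrite /nu /pushforward -comp_preimage (_ : _ \o _ = id) ?preimage_id//.
exact/funext.
Qed.

HB.instance Definition _ := Measure_isSigmaFinite.Build _ _ _ nu
  nu_sigma_finite.

Lemma pushforward_sigma_finiteP :
  exists nu' : {sigma_finite_measure set T2 -> \bar R}, pushforward m f = nu'.
Proof. by exists nu. Qed.

End pushforward_sigma_finite.

Lemma lebesgue_tupleP (R : realType) (n : nat) :
  exists m : {sigma_finite_measure set (n.-tuple (measurableTypeR R)) -> \bar R},
    lebesgue_tuple n = m.
Proof.
elim: n => [|n [m mE]].
  by exists (dirac ([tuple] : 0.-tuple (measurableTypeR R))).
pose uncons (x : n.+1.-tuple (measurableTypeR R)) :=
  (thead x, [tuple of behead x]).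
rewrite /= mE.
apply: (@pushforward_sigma_finiteP _ _ _ _ _
  (@lebesgue_measure R \x m)%E _ uncons).
- exact: sigma_finite_prod.
- exact: measurable_cons.
- apply/measurable_fun_pairP; split => //=.
    exact: (measurable_tnth ord0).
  exact: measurable_behead.
- by move=> [a b]; congr pair; apply/val_inj.
Qed.

Section lebesgue_tuple_measure.
Variables (R : realType) (n : nat).

Let mu := @lebesgue_tuple R n.

Let mu0 : mu set0 = 0%E.
Proof. by rewrite /mu; have [m ->] := lebesgue_tupleP R n. Qed.

Let mu_ge0 A : (0 <= mu A)%E.
Proof. by rewrite /mu; have [m ->] := lebesgue_tupleP R n. Qed.

Let mu_sigma_additive : semi_sigma_additive mu.
Proof.
rewrite /mu; have [m ->] := lebesgue_tupleP R n.
exact: measure_semi_sigma_additive.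
Qed.

HB.instance Definition _ := isMeasure.Build _ _ _ (@lebesgue_tuple R n)
  mu0 mu_ge0 mu_sigma_additive.

Let mu_sigma_finite : sigma_finite setT mu.
Proof.
rewrite /mu; have [m ->] := lebesgue_tupleP R n; exact: sigma_finiteT.
Qed.

HB.instance Definition _ := Measure_isSigmaFinite.Build _ _ _
  (@lebesgue_tuple R n) mu_sigma_finite.

End lebesgue_tuple_measure.

Lemma measurable_preimage_rV d (T : measurableType d) (R : realType) (m : nat)
    (f : T -> 'rV[R]_m) (V : set 'rV[R]_m) :
  (forall i, measurable_fun setT (fun t => f t ord0 i)) ->
  open V -> measurable (f @^-1` V).
Proof.
move=> mf oV.
pose box (q : {ffun 'I_m -> rat * rat}) : set 'rV[R]_m :=
  [set v | forall i, v ord0 i \in `]ratr (q i).1, ratr (q i).2[].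
pose F q := if `[< box q `<=` V >] then f @^-1` box q else set0.
have -> : f @^-1` V = \bigcup_q F q.
  apply/seteqP; split => [t Vt|t [q _]]; last first.
    by rewrite /F; case: ifPn => // /asboolP qV /qV.
  move: oV; rewrite openE => /(_ _ Vt) /nbhs_ballP[e /= e0 eV].
  have lo i : exists q : rat, f t ord0 i - e < ratr q < f t ord0 i.
    have [|q] := @rat_in_itvoo R (f t ord0 i - e) (f t ord0 i).
      by rewrite ltrBlDr ltrDl.
    by rewrite in_itv /=; exists q.
  have hi i : exists q : rat, f t ord0 i < ratr q < f t ord0 i + e.
    have [|q] := @rat_in_itvoo R (f t ord0 i) (f t ord0 i + e).
      by rewrite ltrDl.
    by rewrite in_itv /=; exists q.
  have [{}lo loP] := choice lo; have [{}hi hiP] := choice hi.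
  pose q := [ffun i => (lo i, hi i)].
  exists q => //; rewrite /F asboolT; last first.
    move=> v /= qv; apply: eV; split => // i j.
    rewrite ord1 -ball_normE /=; move: (qv j) (loP j) (hiP j).
    rewrite ffunE in_itv /= => /andP[? ?] /andP[? ?] /andP[? ?].
    by rewrite distrC ltr_distl; apply/andP; split; lra.
  move=> i; rewrite ffunE in_itv /=.
  by have /andP[_ ->] := loP i; have /andP[-> _] := hiP i.
apply: countable_bigcupT_measurable => [|q]; first exact: countableP.
rewrite /F; case: ifP => // _.
have -> : f @^-1` box q = \bigcap_(i in [set: 'I_m])
    ((fun t => f t ord0 i) @^-1` `]ratr (q i).1, ratr (q i).2[%classic).
  by apply/seteqP; split => [t /= + i _|t /= + i]; [exact|move=> /(_ i); exact].
apply: fin_bigcap_measurable => // i _.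
by rewrite -[X in measurable X]setTI; exact: mf.
Qed.

Section hchart.
Variables (R : realType) (n : nat).
Implicit Type y : n.-tuple (measurableTypeR R).

Definition hchart0 y : R := Num.sqrt (1 + \sum_(i < n) (tnth y i : R) ^+ 2).

Definition hchart_row y : 'rV[R]_n.+1 :=
  \row_i if unlift ord0 i is Some j then tnth y j else hchart0 y.

Lemma hchart0_gt0 y : 0 < hchart0 y.
Proof. by rewrite sqrtr_gt0 ltr_pwDl// sumr_ge0// => i _; exact: sqr_ge0. Qed.

Lemma hchart_subproof y : hchart_row y \in @hyperboloid R n.
Proof.
rewrite inE /hyperboloid /= mxE unlift_none hchart0_gt0; split => //.
under eq_bigr => i _ do rewrite mxE liftK.
rewrite sqr_sqrtr; first by rewrite opprD addrNK.
by rewrite addr_ge0// sumr_ge0// => i _; exact: sqr_ge0.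
Qed.

Definition hchart y : Hyp R n := SigSub (hchart_subproof y).

Lemma measurable_hchart0 : measurable_fun setT hchart0.
Proof.
apply: (measurableT_comp (f := @Num.sqrt R)).
  by apply: continuous_measurable_fun; exact: sqrt_continuous.
apply: measurable_funD => //; apply: measurable_sum => i.
by apply: measurable_funX; exact: measurable_tnth.
Qed.

Lemma measurable_hchart : measurable_fun setT hchart.
Proof.
apply: (measurability (@open (Hyp R n))) => // _ [_ [V oV <-] <-].
rewrite setTI -comp_preimage; apply: measurable_preimage_rV oV => i.
under eq_fun do rewrite /= mxE.
case: unlift => [j|]; first exact: measurable_tnth.
exact: measurable_hchart0.
Qed.

End hchart.

(* Riemannian volume: H^n is the graph of y |-> sqrt (1 + |y|^2), on which the
   metric induced by the Lorentzian form has determinant 1 / x_0^2 in the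
   coordinates y = (x_1, ..., x_n). *)
Definition hvol {R : realType} {n : nat} (A : set (Hyp R n)) : \bar R :=
  (\int[lebesgue_tuple n]_(y in @hchart R n @^-1` A) ((hchart0 y)^-1)%:E)%E.

Section hvol_measure.
Variables (R : realType) (n : nat).
Local Open Scope ereal_scope.

Let hvol0 : @hvol R n set0 = 0.
Proof. by rewrite /hvol preimage_set0 integral_set0. Qed.

Let hvol_ge0 A : 0 <= @hvol R n A.
Proof.
by apply: integral_ge0 => y _; rewrite lee_fin invr_ge0 ltW// hchart0_gt0.
Qed.

Let hvol_sigma_additive : semi_sigma_additive (@hvol R n).
Proof.
move=> F mF tF mUF; rewrite /hvol preimage_bigcup; apply: cvg_toP.
  apply: ereal_nondecreasing_is_cvgn => k l kl.
  apply: lee_sum_nneg_natr => // i _ _.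
  exact: hvol_ge0.
rewrite ge0_integral_bigcup//=.
- move=> i; rewrite -[X in measurable X]setTI; exact: measurable_hchart.
- apply: measurable_funTS; apply/measurable_EFinP.
  rewrite (_ : (fun _ => _) = fun y => powR (hchart0 y) (-1)).
    apply: (measurableT_comp (measurable_powR (-1)%R)).
    exact: measurable_hchart0.
  by apply/funext => y; rewrite powR_inv1// ltW// hchart0_gt0.
- by move=> y _; rewrite lee_fin invr_ge0 ltW// hchart0_gt0.
- apply/trivIsetP => i j _ _ ij; rewrite -preimage_setI.
  by move/trivIsetP : tF => /(_ _ _ _ _ ij) ->//; rewrite preimage_set0.
Qed.

HB.instance Definition _ := isMeasure.Build _ _ _ (@hvol R n)
  hvol0 hvol_ge0 hvol_sigma_additive.

End hvol_measure.

Section energy.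
Variables (R : realType) (n : nat).
Implicit Types (K : R -> \bar R) (rho : probability (Hyp R n) R).

(* A function [0, +oo[ -> R U {+oo} is encoded as K : R -> \bar R whose values
   on ]-oo, 0[ are irrelevant, as hdist is nonnegative. *)
Definition energy K rho : \bar R :=
  ((2^-1)%:E * \int[rho \x rho]_p K (hdist p.1 p.2))%E.

Definition minimizer K rho : Prop :=
  forall nu : probability (Hyp R n) R, (energy K rho <= energy K nu)%E.

Definition msupport rho : set (Hyp R n) :=
  [set x | forall U, open U -> U x -> (0 < rho U)%E].

End energy.

(* Main.v *)
Require Import Defs.
From HB Require Import structures.
From mathcomp Require Import all_boot all_order all_algebra.
From mathcomp Require Import all_classical all_reals all_analysis.
From mathcomp Require Import measurable_realfun.
From mathcomp Require Import ring lra.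

(** Write F(x, y) = K(d(x, y)) - Kmin >= 0 and let J0 be the infimum over
    probabilities of the double integral of F. Instability gives a level a > J0
    and a distance L such that F >= a on pairs at distance at least L.

    Concentration. Let rho have energy at most J0 + e, and split the space into
    a set A and its complement. The self-interactions of the two parts are at
    least J0 rho(A)^2 and J0 (1 - rho(A))^2, by comparison with the normalized
    restrictions of rho; hence the cross term, counted twice, is at most
    2 J0 rho(A) (1 - rho(A)) + e ([interaction_compl_le]). If A is a ball of
    radius r + L around x, the ball of radius r around x is at distance at least
    L from the complement of A, so the same cross term is at least
    2 a rho(B(x, r)) (1 - rho(A)) ([ball_mass_step]). As a > J0, the mass
    outside B(x, r) decays at a rate that depends on a, J0 and L only, provided
    that x is chosen with rho(B(x, L)) bounded below, which is possible because
    otherwise most pairs would be at distance at least L ([exists_center]). For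
    e = 0 the mass outside a large enough ball vanishes ([ball_mass_eq1]), which
    bounds the diameter of the support of every minimizer. For e small it gives
    tightness ([ball_mass_compl_le]).

    Existence. Recenter a minimizing sequence at the vertex by point reflections
    ([recenter]); it is then tight. Along an ultrafilter, the masses of open sets
    converge, and the outer measure that they generate through countable open
    covers satisfies Caratheodory's criterion for the coordinate functions, so it
    restricts to a Borel probability m with m(O) <= lim rho_k(O) for O open
    ([tight_weak_limit]). This semicontinuity passes to products, because open
    sets of the product are increasing unions of finite unions of boxes
    ([le_liminf_open2]), and then to integrals of nonnegative lower
    semicontinuous functions, approximated from below by combinations of
    indicators of superlevel sets ([le_liminf_integral]). Hence the energy of m
    is minimal. *)

Set Implicit Arguments.
Unset Strict Implicit.
Unset Printing Implicit Defensive.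

Import Order.TTheory GRing.Theory Num.Theory.
Import numFieldNormedType.Exports.
Local Open Scope classical_set_scope.
Local Open Scope ring_scope.

(** * The hyperbolic distance *)

Lemma discriminant_le (R : realFieldType) (a b c : R) :
  (forall s t : R, 0 <= a * s ^+ 2 + 2 * b * (s * t) + c * t ^+ 2) ->
  b ^+ 2 <= a * c.
Proof.
move=> h; have a0 : 0 <= a by have := h 1 0; lra.
have c0 : 0 <= c by have := h 0 1; lra.
have ha : 0 <= a * (a * c - b ^+ 2).
  by apply: le_trans (h b (- a)) _; rewrite le_eqVlt; apply/orP; left; apply/eqP; ring.
have hc : 0 <= c * (a * c - b ^+ 2).
  by apply: le_trans (h c (- b)) _; rewrite le_eqVlt; apply/orP; left; apply/eqP; ring.
have [a_gt0|a_le0] := ltP 0 a.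
  by rewrite -subr_ge0; rewrite pmulr_rge0 in ha.
have [c_gt0|c_le0] := ltP 0 c.
  by rewrite -subr_ge0; rewrite pmulr_rge0 in hc.
have -> : a = 0 by lra.
have cE : c = 0 by lra.
have aE : a = 0 by lra.
have := h 1 (- b); rewrite aE cE; nra.
Qed.

Lemma sum_CauchySchwarz (R : realFieldType) (n : nat) (a b : 'I_n -> R) :
  (\sum_i a i * b i) ^+ 2 <= (\sum_i a i ^+ 2) * (\sum_i b i ^+ 2).
Proof.
apply: discriminant_le => s t.
have -> : (\sum_i a i ^+ 2) * s ^+ 2 + 2 * (\sum_i a i * b i) * (s * t) +
    (\sum_i b i ^+ 2) * t ^+ 2 = \sum_i (a i * s + b i * t) ^+ 2.
  rewrite mulr_sumr !mulr_suml -!big_split/=; apply: eq_bigr => i _; ring.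
by apply: sumr_ge0 => i _; exact: sqr_ge0.
Qed.

Section lorentz.
Variables (R : realType) (n : nat).
Implicit Types (u v w : 'rV[R]_n.+1) (x y z : Hyp R n).

(** The Lorentz form with the sign convention that makes it positive on
    timelike vectors, so that [hdist x y] is the [arcosh] of [lform x y]. *)
Definition lform u v : R :=
  u ord0 ord0 * v ord0 ord0 -
  \sum_(i < n) u ord0 (lift ord0 i) * v ord0 (lift ord0 i).

Lemma hdistE x y : hdist x y = arcosh (lform (\val x) (\val y)).
Proof. by []. Qed.

Lemma lformC u v : lform u v = lform v u.
Proof.
by rewrite /lform mulrC; congr (_ - _); apply: eq_bigr => i _; rewrite mulrC.
Qed.

Lemma lformDl u v w : lform (u + v) w = lform u w + lform v w.
Proof.
rewrite /lform mxE mulrDl.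
under eq_bigr do rewrite mxE mulrDl.
by rewrite big_split/=; ring.
Qed.

Lemma lformZl a u v : lform (a *: u) v = a * lform u v.
Proof.
rewrite /lform mxE.
under eq_bigr do rewrite mxE -mulrA.
by rewrite -mulr_sumr; ring.
Qed.

Lemma lformDr u v w : lform w (u + v) = lform w u + lform w v.
Proof. by rewrite !(lformC w) lformDl. Qed.

Lemma lformZr a u v : lform u (a *: v) = a * lform u v.
Proof. by rewrite !(lformC u) lformZl. Qed.

Lemma hyperboloidP u :
  @hyperboloid R n u <-> lform u u = 1 /\ 0 < u ord0 ord0.
Proof.
rewrite /hyperboloid/= /lform.
under [in X in _ <-> X]eq_bigr do rewrite -expr2.
by split=> -[h1 h2]; split=> //; move: h1; lra.
Qed.

Lemma lform_hyp x : lform (\val x) (\val x) = 1.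
Proof. by have /set_mem/hyperboloidP[] := valP x. Qed.

Lemma hyp0_gt0 x : 0 < \val x ord0 ord0.
Proof. by have /set_mem/hyperboloidP[] := valP x. Qed.

Lemma sum_sqr_hyp x :
  \sum_(i < n) \val x ord0 (lift ord0 i) ^+ 2 = \val x ord0 ord0 ^+ 2 - 1.
Proof. by have /set_mem[h _] := valP x; rewrite -h; lra. Qed.

(** The orthogonal complement of a timelike vector is spacelike. *)
Lemma lform_orthogonal u y : lform u (\val y) = 0 -> lform u u <= 0.
Proof.
move=> /eqP; rewrite subr_eq0 => /eqP uy.
have := sum_CauchySchwarz (fun i => u ord0 (lift ord0 i))
  (fun i => \val y ord0 (lift ord0 i)).
rewrite -uy sum_sqr_hyp /lform.
under [X in _ -> _ - X <= _]eq_bigr do rewrite -expr2.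
have : 0 <= \sum_(i < n) u ord0 (lift ord0 i) ^+ 2.
  by apply: sumr_ge0 => i _; exact: sqr_ge0.
move: (\sum_(i < n) _) (u ord0 ord0) (hyp0_gt0 y) => S a.
move: (\val y ord0 ord0) => b b0 S0 h.
rewrite subr_le0 -expr2 -(@ler_pM2r _ (b ^+ 2)) ?exprn_gt0//.
nra.
Qed.

Lemma lform_hyp_gt0 x y : 0 < lform (\val x) (\val y).
Proof.
have := sum_CauchySchwarz (fun i => \val x ord0 (lift ord0 i))
  (fun i => \val y ord0 (lift ord0 i)).
have : 0 <= \val x ord0 ord0 ^+ 2 - 1.
  by rewrite -sum_sqr_hyp; apply: sumr_ge0 => i _; exact: sqr_ge0.
rewrite !sum_sqr_hyp /lform.
move: (\sum_(i < n) _) (hyp0_gt0 x) (hyp0_gt0 y) => S.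
move: (\val x ord0 ord0) (\val y ord0 ord0) => a b a0 b0 a1 h.
have ab : 0 < a * b by rewrite mulr_gt0.
rewrite subr_gt0.
have [//|abS] := ltP S (a * b).
have : (a * b) ^+ 2 <= S ^+ 2 by rewrite ler_sqr// nnegrE; lra.
rewrite exprMn.
nra.
Qed.

Lemma lform_hyp_ge1 x y : 1 <= lform (\val x) (\val y).
Proof.
set p := lform _ _.
have := @lform_orthogonal (\val x + (- p) *: \val y) y.
rewrite !(lformDl, lformDr, lformZl, lformZr) !lform_hyp (lformC (\val y)) -/p.
move=> /(_ _)/wrap[|h]; first by ring.
have := lform_hyp_gt0 x y; rewrite -/p; nra.
Qed.

(** Cauchy-Schwarz for the components of [x] and [z] orthogonal to [y]. *)
Lemma lform_triangle x y z :
  (lform (\val x) (\val y) * lform (\val y) (\val z) -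
    lform (\val x) (\val z)) ^+ 2 <=
  (lform (\val x) (\val y) ^+ 2 - 1) * (lform (\val y) (\val z) ^+ 2 - 1).
Proof.
apply: discriminant_le => s t.
set p := lform (\val x) (\val y); set q := lform (\val y) (\val z).
set r := lform (\val x) (\val z).
have := @lform_orthogonal
  (s *: \val x + t *: \val z + (- (s * p + t * q)) *: \val y) y.
rewrite !(lformDl, lformDr, lformZl, lformZr) !lform_hyp.
rewrite (lformC (\val z) (\val y)) (lformC (\val z) (\val x)).
rewrite (lformC (\val y) (\val x)) -/p -/q -/r.
move=> /(_ _)/wrap[|h]; first by ring.
by move: h; lra.
Qed.

Lemma hdist_ge0 x y : 0 <= hdist x y.
Proof. exact/arcosh_ge0/lform_hyp_ge1. Qed.

Lemma hdistC x y : hdist x y = hdist y x.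
Proof. by rewrite !hdistE lformC. Qed.

Lemma cosh_hdist x y : cosh (hdist x y) = lform (\val x) (\val y).
Proof. exact/arcoshK/lform_hyp_ge1. Qed.

End lorentz.

Lemma ler_arcosh (R : realType) (a b : R) : 1 <= a -> a <= b ->
  arcosh a <= arcosh b.
Proof.
move=> a1 ab; have b1 : 1 <= b by exact: le_trans ab.
have sa := sqrtr_ge0 (a ^+ 2 - 1); have sb := sqrtr_ge0 (b ^+ 2 - 1).
rewrite /arcosh ler_ln ?posrE; [|lra..].
rewrite lerD// ler_wsqrtr// lerB// ler_sqr// nnegrE; lra.
Qed.

Lemma coshD_arcosh (R : realType) (p q : R) : 1 <= p -> 1 <= q ->
  cosh (arcosh p + arcosh q) =
  p * q + Num.sqrt (p ^+ 2 - 1) * Num.sqrt (q ^+ 2 - 1).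
Proof.
move=> p1 q1.
have aux (u : R) : 1 <= u -> expR (arcosh u) = u + Num.sqrt (u ^+ 2 - 1) /\
    expR (- arcosh u) = u - Num.sqrt (u ^+ 2 - 1).
  move=> u1; have s0 := sqrtr_ge0 (u ^+ 2 - 1).
  have sE : Num.sqrt (u ^+ 2 - 1) ^+ 2 = u ^+ 2 - 1.
    by rewrite sqr_sqrtr// subr_ge0 exprn_ege1.
  have us : 0 < u + Num.sqrt (u ^+ 2 - 1) by lra.
  rewrite expRN /arcosh lnK ?posrE//; split => //.
  apply: (mulfI (lt0r_neq0 us)); rewrite mulfV ?lt0r_neq0//; lra.
have [p2 p3] := aux p p1; have [q2 q3] := aux q q1.
by rewrite /cosh opprD !expRD p2 p3 q2 q3; field.
Qed.

Lemma hdist_triangle (R : realType) (n : nat) (x y z : Hyp R n) :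
  hdist x z <= hdist x y + hdist y z.
Proof.
have := lform_triangle x y z; rewrite !hdistE.
have := lform_hyp_ge1 x y; have := lform_hyp_ge1 y z.
have := lform_hyp_ge1 x z.
move: (lform _ _) (lform _ _) (lform _ _) => r q p r1 q1 p1 h.
rewrite -[leRHS]coshK ?addr_ge0 ?arcosh_ge0//.
apply: ler_arcosh => //; rewrite coshD_arcosh// addrC -lerBlDr.
rewrite -sqrtrM ?subr_ge0 ?exprn_ege1//.
apply: le_trans (ler_norm _) _.
by rewrite distrC -sqrtr_sqr ler_wsqrtr.
Qed.

(** * Topology of the hyperbolic space *)

Section topology.
Variables (R : realType) (n : nat).
Implicit Types (u v w : 'rV[R]_n.+1) (x y z : Hyp R n).

Lemma continuous_val_hyp : continuous (fun x : Hyp R n => \val x).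
Proof. exact: initial_continuous. Qed.

Lemma continuous_hcoord i : continuous (fun x : Hyp R n => \val x ord0 i : R).
Proof.
move=> x; apply: (@continuous_comp _ _ _ (fun x : Hyp R n => \val x)
  (fun u : 'rV[R]_n.+1 => u ord0 i)); first exact: continuous_val_hyp.
exact: coord_continuous.
Qed.

Lemma continuous_lform (T : topologicalType) (f g : T -> 'rV[R]_n.+1) :
  continuous f -> continuous g -> continuous (fun t => lform (f t) (g t) : R).
Proof.
have cc (h : T -> 'rV[R]_n.+1) i :
    continuous h -> continuous (fun t => h t ord0 i : R).
  move=> ch t; apply: (@continuous_comp _ _ _ h
    (fun u : 'rV[R]_n.+1 => u ord0 i)); [exact: ch|exact: coord_continuous].
move=> cf cg t; rewrite /lform; apply: cvgB.
  by apply: cvgM; exact: cc.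
apply: cvg_big => [|i _]; first exact: add_continuous.
by apply: cvgM; exact: cc.
Qed.

Lemma continuous_hdist : continuous (fun p : Hyp R n * Hyp R n => hdist p.1 p.2).
Proof.
have cl : continuous
    (fun p : Hyp R n * Hyp R n => lform (\val p.1) (\val p.2) : R).
  apply: continuous_lform => p.
    by apply: continuous_comp; [exact: cvg_fst|exact: continuous_val_hyp].
  by apply: continuous_comp; [exact: cvg_snd|exact: continuous_val_hyp].
move=> p; rewrite /hdist -/(lform _ _) /arcosh.
have l1 := lform_hyp_ge1 p.1 p.2.
apply: (@continuous_comp _ _ _
  (fun p : Hyp R n * Hyp R n => lform (\val p.1) (\val p.2) +
     Num.sqrt (lform (\val p.1) (\val p.2) ^+ 2 - 1))); last first.
  by apply: continuous_ln; rewrite ltr_wpDr ?sqrtr_ge0// (lt_le_trans _ l1).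
apply: cvgD; first exact: cl.
apply: (@continuous_comp _ _ _
  (fun p : Hyp R n * Hyp R n => lform (\val p.1) (\val p.2) ^+ 2 - 1)).
  apply: cvgB; last exact: cvg_cst.
  rewrite expr2; under eq_fun do rewrite expr2.
  by apply: cvgM; exact: cl.
exact: sqrt_continuous.
Qed.

Lemma continuous_hdistr x : continuous (fun y : Hyp R n => hdist y x).
Proof.
move=> y; apply: (@continuous_comp _ _ _ (fun y : Hyp R n => (y, x))
  (fun p : Hyp R n * Hyp R n => hdist p.1 p.2)); last exact: continuous_hdist.
move=> A [[B C] /= [By Cx] BCA]; apply: filterS By => z Bz.
by apply: BCA; split => //=; exact: nbhs_singleton Cx.
Qed.

(** Open boxes with rational endpoints form a countable base. *)
Definition hbox (q : {ffun 'I_n.+1 -> rat * rat}) : set (Hyp R n) :=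
  [set x : Hyp R n | forall i, \val x ord0 i \in `]ratr (q i).1, ratr (q i).2[].

Lemma open_hbox q : open (hbox q).
Proof.
rewrite openE => x qx; rewrite /interior.
have := @filter_forall (Hyp R n) 'I_n.+1 (fun i => [set y : Hyp R n |
  \val y ord0 i \in `]ratr (q i).1, ratr (q i).2[]) (nbhs x) _.
apply=> i.
apply: (@continuous_hcoord i x `]ratr (q i).1, ratr (q i).2[%classic).
apply: open_nbhs_nbhs; split.
  exact: interval_open.
exact: qx.
Qed.

Lemma hbox_nbhs x (U : set (Hyp R n)) : nbhs x U ->
  exists2 q, hbox q x & hbox q `<=` U.
Proof.
move=> [_ [[V oV <-] /= Vx VU]].
move: oV; rewrite openE => /(_ _ Vx) /nbhs_ballP[e /= e0 eV].
have lo i : exists q : rat, \val x ord0 i - e < ratr q < \val x ord0 i.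
  have [|q] := @rat_in_itvoo R (\val x ord0 i - e) (\val x ord0 i).
    by rewrite ltrBlDr ltrDl.
  by rewrite in_itv /=; exists q.
have hi i : exists q : rat, \val x ord0 i < ratr q < \val x ord0 i + e.
  have [|q] := @rat_in_itvoo R (\val x ord0 i) (\val x ord0 i + e).
    by rewrite ltrDl.
  by rewrite in_itv /=; exists q.
have [{}lo loP] := choice lo; have [{}hi hiP] := choice hi.
exists [ffun i => (lo i, hi i)].
  move=> i; rewrite ffunE in_itv /=.
  by have /andP[_ ->] := loP i; have /andP[-> _] := hiP i.
move=> y qy; apply: VU; apply: eV; split => // i j.
rewrite ord1 -ball_normE /=; move: (qy j) (loP j) (hiP j).
rewrite ffunE in_itv /= => /andP[? ?] /andP[? ?] /andP[? ?].
by rewrite distrC ltr_distl; apply/andP; split; lra.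
Qed.

Lemma open_measurable_hyp (U : set (Hyp R n)) : open U -> measurable U.
Proof. by move=> oU; apply: sub_sigma_algebra. Qed.

Lemma measurable_fun_hyp (f : Hyp R n -> R) :
  continuous f -> measurable_fun setT f.
Proof.
move=> cf; apply: (measurability (@RGenOInfty.G R)).
  exact: RGenOInfty.measurableE.
move=> _ [_ [a ->] <-]; rewrite setTI; apply: open_measurable_hyp.
by apply: open_comp; [move=> x _; exact: cf|exact: interval_open].
Qed.

Lemma open_hdist_lt x (r : R) : open [set y | hdist y x < r].
Proof.
apply: (@open_comp _ _ (fun y => hdist y x) [set t | t < r]) => [y _|].
  exact: continuous_hdistr.
exact: open_lt.
Qed.

Lemma open_hdist_gt x (r : R) : open [set y | r < hdist y x].
Proof.
apply: (@open_comp _ _ (fun y => hdist y x) [set t | r < t]) => [y _|].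
  exact: continuous_hdistr.
exact: open_gt.
Qed.

Lemma measurable_hdist_lt x (r : R) : measurable [set y | hdist y x < r].
Proof. by apply: open_measurable_hyp; exact: open_hdist_lt. Qed.

Lemma measurable_hdist_le x (r : R) : measurable [set y | hdist y x <= r].
Proof.
have -> : [set y | hdist y x <= r] = ~` [set y | r < hdist y x].
  by apply/seteqP; split => y /=; rewrite leNgt => /negP.
by apply: measurableC; apply: open_measurable_hyp; exact: open_hdist_gt.
Qed.

(** Open subsets of the product are countable unions of open boxes. *)
Lemma open_hyp2_bigcup (O : set (Hyp R n * Hyp R n)) : open O ->
  exists U V : nat -> set (Hyp R n),
    [/\ forall i, open (U i), forall i, open (V i) &
        O = \bigcup_i (U i `*` V i)].
Proof.
move=> oO.
pose Q := ({ffun 'I_n.+1 -> rat * rat} * {ffun 'I_n.+1 -> rat * rat})%type.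
pose sel (i : nat) : option Q := if unpickle i is Some q then
  if `[< hbox q.1 `*` hbox q.2 `<=` O >] then Some q else None else None.
exists (fun i => if sel i is Some q then hbox q.1 else set0).
exists (fun i => if sel i is Some q then hbox q.2 else set0).
split=> [i|i|].
- by case: sel => [q|]; [exact: open_hbox|exact: open0].
- by case: sel => [q|]; [exact: open_hbox|exact: open0].
- apply/seteqP; split=> [[x y] Oxy|[x y] [i _]]; last first.
    rewrite /sel; case: unpickle => [q|]; last by case.
    by case: ifPn => [/asboolP + |_ []//]; exact.
  move: oO; rewrite openE => /(_ _ Oxy) [[A B] /= [Ax By] AB].
  have [q1 q1x q1A] := hbox_nbhs Ax.
  have [q2 q2y q2B] := hbox_nbhs By.
  exists (pickle ((q1, q2) : Q)) => //=.
  rewrite /sel pickleK asboolT//= => -[a b] /= [? ?].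
  by apply: AB; split; [exact: q1A|exact: q2B].
Qed.

Lemma open_measurable_hyp2 (O : set (Hyp R n * Hyp R n)) :
  open O -> measurable O.
Proof.
move=> /open_hyp2_bigcup[U [V [oU oV ->]]].
by apply: bigcup_measurable => i _; apply: measurableX;
  exact: open_measurable_hyp.
Qed.

Lemma compact_set_val (X : topologicalType) (A C : set X) :
  C `<=` A -> compact C -> compact (@set_val X A @^-1` C).
Proof.
move=> CA cC F PF FC.
have [p [Cp cp]] := cC (@set_val X A @ F) _ FC.
exists (SigSub (mem_set (CA _ Cp))); split => //= E B FE [_ [[W oW <-] Wp WB]].
have [||q [[e Ee eq] Wq]] := cp (@set_val X A @` E) W.
- by apply: (@filterS _ F _ E) FE => t Et; exists t.
- exact: open_nbhs_nbhs.
- by exists e; split => //; apply: WB; rewrite /= eq.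
Qed.

Lemma compact_hyp_le (c : R) : compact [set x : Hyp R n | \val x ord0 ord0 <= c].
Proof.
pose C : set 'rV[R]_n.+1 :=
  [set u | [/\ lform u u = 1, 0 <= u ord0 ord0 & u ord0 ord0 <= c]].
have CH : C `<=` @hyperboloid R n.
  move=> u [u1 u0 uc]; apply/hyperboloidP; split => //.
  rewrite lt_neqAle u0 andbT; apply/eqP => uE.
  move: u1; rewrite /lform -uE mul0r sub0r => h.
  suff : 0 <= \sum_(i < n) u ord0 (lift ord0 i) * u ord0 (lift ord0 i) by lra.
  by apply: sumr_ge0 => i _; rewrite -expr2 sqr_ge0.
suff cC : compact C.
  have := compact_set_val CH cC; congr compact; apply/seteqP; split => x /=.
    by case.
  move=> xc; split => //; first exact: lform_hyp.
  by rewrite ltW// hyp0_gt0.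
have clC : closed C.
  have -> : C = (fun u => lform u u : R) @^-1` [set t | t = 1] `&`
      ((fun u : 'rV[R]_n.+1 => u ord0 ord0 : R) @^-1` [set t | 0 <= t] `&`
      (fun u : 'rV[R]_n.+1 => u ord0 ord0 : R) @^-1` [set t | t <= c]).
    by apply/seteqP; split => [u [? ? ?]|u [? [? ?]]].
  apply: closedI.
    apply: preimage_closed; last exact: closed_eq.
    by move=> u _; apply: continuous_lform => t; exact: cvg_id.
  apply: closedI.
    apply: (@preimage_closed _ _ (fun u : 'rV[R]_n.+1 => u ord0 ord0 : R)).
      by move=> u _; exact: coord_continuous.
    exact: closed_ge.
  apply: (@preimage_closed _ _ (fun u : 'rV[R]_n.+1 => u ord0 ord0 : R)).
    by move=> u _; exact: coord_continuous.
  exact: closed_le.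
apply: subclosed_compact clC
  (@rV_compact _ n.+1 (fun=> `[- c, c]%classic) (fun=> @segment_compact _ _ _)) _.
move=> u [u1 u0 uc] i; rewrite /= in_itv/= -ler_norml.
have c0 : 0 <= c by exact: le_trans uc.
have [j ->|->] := unliftP ord0 i; last by rewrite ger0_norm.
rewrite -(ger0_norm c0) -ler_sqr ?nnegrE// -normrX -(normrX 2 c) !ger0_norm ?sqr_ge0//.
have : u ord0 (lift ord0 j) ^+ 2 <= \sum_(k < n) u ord0 (lift ord0 k) ^+ 2.
  by rewrite (bigD1 j)//= lerDl sumr_ge0// => k _; exact: sqr_ge0.
move: u1; rewrite /lform; under eq_bigr do rewrite -expr2.
by nra.
Qed.

Lemma vertex_lform u : lform u (\val (vertex R n)) = u ord0 ord0.
Proof.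
rewrite /lform /= mxE/= mulr1 big1 ?subr0// => i _.
by rewrite mxE/= mulr0.
Qed.

Lemma compact_hball (r : R) : compact [set x : Hyp R n | hdist x (vertex R n) <= r].
Proof.
apply: (subclosed_compact _ (@compact_hyp_le (expR r))).
  have := @preimage_closed _ _ (fun x : Hyp R n => hdist x (vertex R n))
    [set t | t <= r] _ (@closed_le _ r).
  by apply=> x _; exact: continuous_hdistr.
move=> x /= xr; rewrite -vertex_lform -cosh_hdist /cosh.
have d0 := hdist_ge0 x (vertex R n).
have : expR (hdist x (vertex R n)) <= expR r by rewrite ler_expR.
have : expR (- hdist x (vertex R n)) <= expR (hdist x (vertex R n)).
  by rewrite ler_expR; lra.
by lra.
Qed.

End topology.

(** * Point reflections *)

Section reflection.
Variables (R : realType) (n : nat).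
Implicit Types (u v w : 'rV[R]_n.+1) (x y z a : Hyp R n).

Let axis a : 'rV[R]_n.+1 := \val a + \val (vertex R n).

Let hrefl_row a z : 'rV[R]_n.+1 :=
  - \val z + (lform (\val z) (axis a) /
    (1 + lform (\val a) (\val (vertex R n)))) *: axis a.

Let lform_hrefl_row a x y :
  lform (hrefl_row a x) (hrefl_row a y) = lform (\val x) (\val y).
Proof.
have c1 := lform_hyp_ge1 a (vertex R n).
have Nl u v : lform (- u) v = - lform u v.
  by rewrite -scaleN1r lformZl mulN1r.
have Nr u v : lform u (- v) = - lform u v by rewrite lformC Nl lformC.
have ww : lform (axis a) (axis a) =
    2 * (1 + lform (\val a) (\val (vertex R n))).
  rewrite !(lformDl, lformDr) !lform_hyp (lformC (\val (vertex R n))); ring.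
rewrite /hrefl_row; move: (axis a) ww c1 => w ww c1.
rewrite !(lformDl, lformDr, lformZl, lformZr) !(Nl, Nr) ww.
rewrite (lformC w (\val y)).
by field; lra.
Qed.

Let hrefl_row_center a : hrefl_row a a = \val (vertex R n).
Proof.
have c1 := lform_hyp_ge1 a (vertex R n).
rewrite /hrefl_row lformDr lform_hyp divff ?scale1r ?addKr//.
by apply/eqP; lra.
Qed.

Lemma hrefl_subproof a z : hrefl_row a z \in @hyperboloid R n.
Proof.
apply/mem_set/hyperboloidP; split; first by rewrite lform_hrefl_row lform_hyp.
by rewrite -vertex_lform -(hrefl_row_center a) lform_hrefl_row lform_hyp_gt0.
Qed.

(** The point reflection about the midpoint of [a] and the vertex; it
    exchanges these two points. *)
Definition hrefl a z : Hyp R n := SigSub (hrefl_subproof a z).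

Lemma hdist_hrefl a x y : hdist (hrefl a x) (hrefl a y) = hdist x y.
Proof. by rewrite !hdistE lform_hrefl_row. Qed.

Lemma hrefl_center a : hrefl a a = vertex R n.
Proof. by apply: val_inj; exact: hrefl_row_center. Qed.

Lemma measurable_hrefl a : measurable_fun setT (hrefl a).
Proof.
apply: (measurability (@open (Hyp R n))) => // _ [_ [V oV <-] <-].
rewrite setTI -comp_preimage; apply: measurable_preimage_rV oV => i.
pose f z : R := lform (\val z) (axis a) /
    (1 + lform (\val a) (\val (vertex R n))) * axis a ord0 i - \val z ord0 i.
have -> : (fun z => (\val \o hrefl a) z ord0 i) = f.
  by apply/funext => z; rewrite /f [LHS]mxE addrC; congr (_ + _); rewrite mxE.
apply: measurable_funB; last exact: measurable_fun_hyp (@continuous_hcoord R n i).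
apply: measurable_funM; last exact: measurable_cst.
apply: measurable_funM; last exact: measurable_cst.
apply: measurable_fun_hyp.
apply: (@continuous_lform _ _ _ (fun z => \val z) (fun=> axis a)).
  exact: continuous_val_hyp.
exact: cst_continuous.
Qed.

End reflection.

(** * Lower semicontinuity of integrals along a filter *)

Section lower_limit.
Variables (R : realType) (I : Type) (F : set_system I).

(** [a] is at most the lower limit of [b] along the filter [F]. Only real
    thresholds are tested. *)
Definition le_liminf (a : \bar R) (b : I -> \bar R) : Prop :=
  forall t : R, (t%:E < a)%E -> \forall k \near F, (t%:E < b k)%E.

Lemma le_liminf_sup {FF : Filter F} (a : nat -> \bar R) (l : \bar R)
    (b : I -> \bar R) :
  a @ \oo --> l -> (forall i, le_liminf (a i) b) -> le_liminf l b.
Proof.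
move=> al ab t tl; suff [i ti] : exists i, (t%:E < a i)%E by exact: ab ti.
apply/not_existsP => h; move: tl; apply/negP; rewrite -leNgt.
rewrite -(cvg_lim _ al)//; apply: lime_le; first by apply/cvg_ex; exists l.
by apply: nearW => i; rewrite leNgt; exact/negP.
Qed.

End lower_limit.

Section layers.
Variables (R : realType) (T : Type) (f : T -> \bar R) (e : R).
Hypotheses (f0 : forall x, (0 <= f x)%E) (e0 : 0 < e).

(** A step function between [f - e] and [f] as long as [f] is below
    [e * N.+1]; it only depends on the superlevel sets of [f]. *)
Definition layers (N : nat) (x : T) : R :=
  \sum_(j < N) e * \1_[set x | ((e * j.+1%:R)%:E < f x)%E] x.

Lemma layers_le N x : ((layers N x)%:E <= Order.min (f x) (e * N%:R)%:E)%E.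
Proof.
elim: N => [|N IH]; rewrite /layers.
  by rewrite big_ord0 mulr0 le_min f0 lexx.
rewrite big_ord_recr/= -/(layers N x) indicE.
move: IH; rewrite !le_min => /andP[h1 h2].
case: (boolP (x \in _)) => [|_]; last first.
  rewrite mulr0 addr0 h1/= (le_trans h2)// lee_fin ler_pM2l// ler_nat.
  exact: leqnSn.
rewrite inE/= mulr1 => /ltW h; rewrite -andbC; apply/andP.
have h3 : ((layers N x + e)%:E <= (e * N.+1%:R)%:E)%E.
  by move: h2; rewrite !lee_fin -natr1 mulrDr mulr1 lerD2r.
by split => //; exact: le_trans h.
Qed.

Lemma le_layers N x :
  (Order.min (f x) (e * N.+1%:R)%:E <= (e + layers N x)%:E)%E.
Proof.
elim: N => [|N IH]; rewrite /layers.
  by rewrite big_ord0 mulr1 addr0 ge_min lexx orbT.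
rewrite big_ord_recr/= -/(layers N x) indicE.
case: (boolP (x \in _)) => [|].
  rewrite inE/= mulr1 => /ltW h; rewrite ge_min; apply/orP; right.
  move: IH; rewrite min_r// !lee_fin -(natr1 N.+1) mulrDr mulr1 addrA.
  by rewrite lerD2r.
move=> xN; rewrite mulr0 addr0.
have h : (f x <= (e * N.+1%:R)%:E)%E.
  by rewrite leNgt; apply: contra xN; rewrite inE.
by move: IH; rewrite min_l// => IH; rewrite ge_min IH.
Qed.

End layers.

Section integral_lower_limit.
Context d (T : measurableType d) (R : realType).
Variables (I : Type) (F : set_system I).
Context {FF : Filter F}.
Variables (m : probability T R) (mk : I -> probability T R).
Local Open Scope ereal_scope.

Let integral_layers (P : probability T R) (f : T -> \bar R) (e : R) N :
  (0 < e)%R -> (forall a : R, measurable [set x | a%:E < f x]) ->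
  \int[P]_x (layers f e N x)%:E =
  (\sum_(j < N) e * fine (P [set x | ((e * j.+1%:R)%:E < f x)%E]))%:E.
Proof.
move=> e0 mf.
under eq_integral do rewrite /layers -sumEFin.
rewrite ge0_integral_sum//; last 2 first.
- by move=> j; apply/measurable_EFinP; exact: measurable_funM.
- by move=> j x _; rewrite lee_fin mulr_ge0// ltW.
rewrite -sumEFin; apply: eq_bigr => j _.
under eq_integral do rewrite EFinM.
rewrite ge0_integralZl//=; last 2 first.
- by apply/measurable_EFinP; exact: measurable_indic.
- by rewrite lee_fin ltW.
by rewrite integral_indic// setIT [RHS]EFinM fineK// fin_num_measure.
Qed.

Let measurable_layers (f : T -> \bar R) (e : R) N :
  (forall a : R, measurable [set x | a%:E < f x]) ->
  measurable_fun setT (fun x => (layers f e N x)%:E).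
Proof.
move=> mf; apply/measurable_EFinP; apply: measurable_sum => j.
exact: measurable_funM.
Qed.

Lemma measurable_fun_superlevel (f : T -> \bar R) :
  (forall a : R, measurable [set x | a%:E < f x]) -> measurable_fun setT f.
Proof.
move=> mf; apply: (measurability _ (ErealGenOInfty.measurableE R)).
move=> _ [_ [a ->] <-]; rewrite setTI.
have -> : f @^-1` `]a%:E, +oo[ = [set x | a%:E < f x].
  by apply/seteqP; split => x /=; rewrite in_itv/= andbT.
exact: mf.
Qed.

(** The portmanteau inequality for a nonnegative function, from the one for its
    superlevel sets. *)
Lemma le_liminf_integral (f : T -> \bar R) : (forall x, 0 <= f x) ->
  (forall a : R, measurable [set x | a%:E < f x]) ->
  (forall a : R, (0 < a)%R ->
    le_liminf F (m [set x | a%:E < f x]) (fun k => mk k [set x | a%:E < f x])) ->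
  le_liminf F (\int[m]_x f x) (fun k => \int[mk k]_x f x).
Proof.
move=> f0 msf h t tf.
have mf := measurable_fun_superlevel msf.
pose g (M : nat) x := Order.min (f x) (M%:R)%:E.
have mg M : measurable_fun setT (g M).
  by apply: measurable_mine => //; exact: measurable_cst.
have g0 M x : 0 <= g M x by rewrite le_min f0 lee_fin ler0n.
have [M tM] : exists M, t%:E < \int[m]_x g M x.
  apply/not_existsP => hM; move: tf; apply/negP; rewrite -leNgt.
  have -> : \int[m]_x f x = \int[m]_x limn (g ^~ x).
    apply: eq_integral => x _; apply/esym/cvg_lim => //.
    case fx : (f x) => [r| |]; last by have := f0 x; rewrite fx.
    - apply: cvg_near_cst; near=> M; rewrite /g fx; apply: min_l.
      by rewrite lee_fin; near: M; exact: nbhs_infty_ger.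
    - rewrite (_ : g ^~ x = fun M => M%:R%:E).
        exact/cvgenyP.
      by apply/funext => M; rewrite /g fx; apply: min_r; exact: leey.
  rewrite monotone_convergence//; last first.
    by move=> x _ a b ab; rewrite /g le_min2// lee_fin ler_nat.
  apply: lime_le.
    apply: ereal_nondecreasing_is_cvgn => a b ab.
    apply: ge0_le_integral => // x _.
    by rewrite /g le_min2// lee_fin ler_nat.
  by apply: nearW => M; rewrite leNgt; exact/negP.
have gM : \int[m]_x g M x <= M%:R%:E.
  rewrite -[leRHS]mule1 -(probability_setT m) -integral_cst//.
  by apply: ge0_le_integral => // x _; rewrite ?lee_fin// ge_min lexx orbT.
have gfin : \int[m]_x g M x \is a fin_num.
  by rewrite ge0_fin_numE ?integral_ge0// (le_lt_trans gM) ?ltry.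
move: tM gM; rewrite -(fineK gfin) lte_fin lee_fin.
set r := fine _ => tr rM.
(* one third of the margin for the step of the layers, one for their masses *)
pose eta : R := ((r - t) / 3)%R.
have eta0 : (0 < eta)%R by rewrite divr_gt0// subr_gt0.
pose N := Num.bound (M.+1%:R / eta)%R; pose e : R := (M.+1%:R / N.+1%:R)%R.
have e0 : (0 < e)%R by rewrite divr_gt0.
have eN : (e * N.+1%:R = M.+1%:R)%R by rewrite divfK// gt_eqF.
have e_eta : (e <= eta)%R.
  rewrite ler_pdivrMr// mulrC -ler_pdivrMr// ltW//.
  have := archi_boundP (ltW (divr_gt0 (ltr0Sn R M) eta0)).
  by move=> /lt_le_trans; apply; rewrite ler_nat.
pose A j := [set x | (e * j.+1%:R)%:E < f x].
have near_levels : \forall k \near F, forall j : 'I_N,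
    (fine (m (A j)) - eta / M.+1%:R < fine (mk k (A j)))%R.
  apply: (@filter_forall _ 'I_N (fun j => [set k |
    (fine (m (A j)) - eta / M.+1%:R < fine (mk k (A j)))%R])) => j.
  have mA : measurable (A j) by exact: msf.
  have mAj : (fine (m (A j)) - eta / M.+1%:R)%:E < m (A j).
    by rewrite -[ltRHS]fineK ?fin_num_measure// lte_fin ltrBlDr ltrDl divr_gt0.
  have ej0 : (0 < e * j.+1%:R)%R by rewrite mulr_gt0.
  apply: filterS (h _ ej0 _ mAj) => k.
  by rewrite /= -lte_fin fineK// fin_num_measure.
apply: filterS near_levels => k hk.
have lower : (\sum_(j < N) e * fine (mk k (A j)))%:E <= \int[mk k]_x f x.
  rewrite -integral_layers//; apply: ge0_le_integral => //.
  - by move=> x _; rewrite lee_fin; apply: sumr_ge0 => j _; rewrite mulr_ge0// ltW.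
  - exact: measurable_layers.
  - by move=> x _; have := layers_le f0 e0 N x; rewrite le_min => /andP[].
apply: lt_le_trans lower; rewrite lte_fin.
have upper : (r <= e + \sum_(j < N) e * fine (m (A j)))%R.
  rewrite -lee_fin fineK// EFinD -integral_layers//.
  rewrite -[X in X + _]mule1 -(probability_setT m) -integral_cst//.
  rewrite -ge0_integralD//; last 3 first.
  - by move=> x _; rewrite lee_fin ltW.
  - by move=> x _; rewrite lee_fin; apply: sumr_ge0 => j _; rewrite mulr_ge0// ltW.
  - exact: measurable_layers.
  apply: ge0_le_integral => //.
  - apply: emeasurable_funD => //; exact: measurable_layers.
  move=> x _ /=; rewrite -EFinD; apply: (le_trans _ (le_layers f e N x)).
  by rewrite eN le_min2// lee_fin ler_nat.
have sumle : (\sum_(j < N) e * fine (m (A j)) - eta <=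
    \sum_(j < N) e * fine (mk k (A j)))%R.
  rewrite lerBlDr -lerBlDl -sumrB.
  apply: (@le_trans _ _ (\sum_(j < N) e * (eta / M.+1%:R))%R).
    apply: ler_sum => j _; rewrite -mulrBr ler_pM2l//.
    by move: (hk j) => /=; move: (eta / _)%R (fine _) (fine _) => q y z; lra.
  rewrite sumr_const card_ord -[leLHS]mulr_natr [leLHS]mulrAC.
  apply: (@le_trans _ _ (M.+1%:R * (eta / M.+1%:R))%R).
    apply: ler_wpM2r; first by rewrite divr_ge0// ltW.
    by rewrite -[leRHS]eN ler_pM2l// ler_nat.
  by rewrite mulrC divfK// gt_eqF.
move: upper sumle e_eta; rewrite /eta; lra.
Unshelve. all: by end_near. Qed.

End integral_lower_limit.

(** * Lower semicontinuity on the product *)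

Section product_lower_limit.
Variables (R : realType) (n : nat) (I : Type) (F : set_system I).
Context {FF : Filter F}.
Variables (m : probability (Hyp R n) R) (mk : I -> probability (Hyp R n) R).
Hypothesis mF : forall O, open O -> le_liminf F (m O) (fun k => mk k O).
Local Open Scope ereal_scope.

(** A finite union of boxes has finitely many sections, so the inequality
    between the masses of the sections is uniform along the filter. *)
Lemma le_liminf_boxes (N : nat) (U V : nat -> set (Hyp R n)) :
  (forall i, open (U i)) -> (forall i, open (V i)) ->
  le_liminf F ((m \x m) (\bigcup_(i < N) (U i `*` V i)))
    (fun k => (mk k \x mk k) (\bigcup_(i < N) (U i `*` V i))).
Proof.
move=> oU oV; set G := \bigcup_(_ < _) _.
have mG : measurable G.
  by apply: bigcup_measurable => i _; apply: measurableX;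
    exact: open_measurable_hyp.
(* the section of G at x only depends on the set S x of the i with x in U i *)
pose S x : {set 'I_N} := [set i : 'I_N | x \in U i]%SET.
pose W (s : {set 'I_N}) := \bigcup_(i in [set i : 'I_N | i \in s]) V i.
have oW s : open (W s) by apply: bigcup_open => i _; exact: oV.
have GE x : xsection G x = W (S x).
  apply/seteqP; split => y; rewrite /xsection/= ?inE.
    move=> [i iN [/= Ux Vy]]; exists (Ordinal iN) => //=.
    by rewrite inE; exact: mem_set.
  move=> [i /=]; rewrite inE => /set_mem Ux Vy.
  by exists i => //=; exact: ltn_ord.
have mW s : measurable (W s) by exact: open_measurable_hyp.
pose f x := m (W (S x)).
have of_ (a : R) : open [set x | a%:E < f x].
  have -> : [set x | a%:E < f x] = \bigcup_(s in [set s | a%:E < m (W s)])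
      [set x | forall i, i \in s -> U i x].
    apply/seteqP; split => [x /= afx|x [s /= as_ xs]].
      by exists (S x) => //= i; rewrite inE => /set_mem.
    apply: lt_le_trans as_ _; apply: le_measure; rewrite ?inE//.
    by move=> y [i /= si Vy]; exists i => //=; rewrite inE; apply/mem_set/xs.
  apply: bigcup_open => s _; rewrite openE => x xs; rewrite /interior.
  have := @filter_forall (Hyp R n) 'I_N
    (fun i => [set y | i \in s -> U i y]) (nbhs x) _.
  apply=> i; have [is_|nis] := boolP (i \in s); last exact: filterE.
  apply: (@filterS _ _ _ (U i)) => [y Uy _ //|].
  by apply: open_nbhs_nbhs; split => //; exact: xs.
have mf : measurable_fun setT f.
  by apply: measurable_fun_superlevel => a; exact: open_measurable_hyp.
have fI : le_liminf F (\int[m]_x f x) (fun k => \int[mk k]_x f x).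
  apply: le_liminf_integral => [x|a|a _]; first exact: measure_ge0.
    exact: open_measurable_hyp.
  exact/mF.
have mGE (P Q : probability (Hyp R n) R) :
    (P \x Q) G = \int[P]_x Q (W (S x)).
  by rewrite /product_measure1; apply: eq_integral => x _ /=; rewrite GE.
move=> t; rewrite mGE -/(f _) => tf.
have ffin : \int[m]_x f x \is a fin_num.
  rewrite ge0_fin_numE ?integral_ge0//; apply: le_lt_trans (ltry 1).
  rewrite -[leRHS]mule1 -[X in _ <= _ * X](probability_setT m) -integral_cst//.
  by apply: ge0_le_integral => // x _; exact: probability_le1.
have [u tu uf] : exists2 u : R, (t < u)%R & u%:E < \int[m]_x f x.
  move: tf; rewrite -(fineK ffin) lte_fin => tf.
  exists ((t + fine (\int[m]_x f x)) / 2)%R; rewrite ?lte_fin; lra.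
have near_sets : \forall k \near F, forall s : {set 'I_N},
    m (W s) <= mk k (W s) + (u - t)%:E.
  apply: (@filter_forall _ {set 'I_N}
    (fun s => [set k | m (W s) <= mk k (W s) + (u - t)%:E])) => s.
  have ms : (fine (m (W s)) - (u - t))%:E < m (W s).
    by rewrite -[ltRHS]fineK ?fin_num_measure// lte_fin; lra.
  apply: filterS (mF (oW s) ms) => k /= /ltW.
  by rewrite EFinB leeBlDr// fineK ?fin_num_measure.
apply: filterS2 (fI _ uf) near_sets => k uk hk.
rewrite mGE.
have mkW : measurable_fun setT (fun x => mk k (W (S x))).
  under eq_fun do rewrite -GE; exact: measurable_fun_xsection.
have : \int[mk k]_x f x <= \int[mk k]_x (mk k (W (S x)) + (u - t)%:E).
  apply: ge0_le_integral => //.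
  - exact: emeasurable_funD.
  - by move=> x _; exact: hk.
rewrite ge0_integralD//; last by move=> x _; rewrite lee_fin subr_ge0 ltW.
rewrite integral_cst// [X in _ * X](_ : _ = 1); last exact: probability_setT.
rewrite mule1 => /(lt_le_trans uk).
by rewrite -lteBlDr// -EFinB opprB addrCA subrr addr0.
Qed.

Lemma le_liminf_open2 (O : set (Hyp R n * Hyp R n)) : open O ->
  le_liminf F ((m \x m) O) (fun k => (mk k \x mk k) O).
Proof.
move=> oO; have mO := open_measurable_hyp2 oO.
have [U [V [oU oV OE]]] := open_hyp2_bigcup oO.
pose G N := \bigcup_(i < N) (U i `*` V i).
have mG N : measurable (G N).
  by apply: bigcup_measurable => i _; apply: measurableX;
    exact: open_measurable_hyp.
have GO : \bigcup_N G N = O.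
  rewrite OE; apply/seteqP; split => [p [N _ [i _ ip]]|p [i _ ip]].
    by exists i.
  by exists i.+1 => //; exists i => /=.
apply: (@le_liminf_sup _ _ _ _ (fun N => (m \x m) (G N))).
  rewrite -[in X in _ --> X]GO; apply: nondecreasing_cvg_mu => //; first by rewrite GO.
  move=> M N MN; apply/subsetPset => p [i /= iM ip].
  by exists i => //=; exact: leq_trans MN.
move=> N t /(le_liminf_boxes oU oV); apply: filterS => k.
move=> /= /lt_le_trans; apply; apply: le_measure; rewrite ?inE//; first exact: (mG N).
by move=> p Gp; rewrite -GO; exists N.
Qed.

Lemma le_liminf_integral2 (f : Hyp R n * Hyp R n -> \bar R) :
  (forall p, 0 <= f p) -> (forall a : R, open [set p | a%:E < f p]) ->
  le_liminf F (\int[m \x m]_p f p) (fun k => \int[mk k \x mk k]_p f p).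
Proof.
move=> f0 of_; apply: le_liminf_integral => // [a|a _].
  exact: open_measurable_hyp2.
exact: le_liminf_open2.
Qed.

End product_lower_limit.

(** * Caratheodory's criterion *)

Section caratheodory_criterion.
Variables (R : realType) (T : Type) (mu : {outer_measure set T -> \bar R}).
Variable f : T -> R.
Hypothesis muf : forall (a b : R) (A B : set T), a < b ->
  (forall x, A x -> f x <= a) -> (forall x, B x -> b <= f x) ->
  (mu A + mu B <= mu (A `|` B))%E.
Hypothesis mu_fin : (mu setT < +oo)%E.
Variable a : R.

Let level (k : nat) : R := a + k.+1%:R^-1.

Let band (X : set T) (k : nat) : set T :=
  X `&` [set x | level k.+2 <= f x < level k.+1].

Let level_lt k : level k.+1 < level k.
Proof. by rewrite ltrD2l ltf_pV2 ?posrE// ltr_nat. Qed.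

(* alternate bands are separated, so they are split into two families *)
Let sum_bands X N : exists A B : set T,
  [/\ (\sum_(k < N) mu (band X k) <= mu A + mu B)%E,
      forall x, A x -> level N <= f x & forall x, B x -> level N.+1 <= f x].
Proof.
elim: N => [|N [A [B [hN fA fB]]]].
  by exists set0, set0; split => //; rewrite big_ord0 outer_measure0 adde0.
exists B, (A `|` band X N); split => //.
- rewrite big_ord_recr/=; apply: le_trans (leeD2r _ hN) _.
  rewrite addeAC addeC leeD2l// addeC setUC.
  apply: muf (level_lt N) _ fA => x [_ /=] /andP[_ /ltW].
  done.
- move=> x [/fA|[_ /= /andP[]]] // h; apply: le_trans h.
  by apply/ltW/(lt_trans (level_lt _))/level_lt.
Qed.

Let bands_summable X : (\sum_(0 <= k <oo) mu (band X k) < +oo)%E.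
Proof.
apply: (@le_lt_trans _ _ (mu setT + mu setT)%E); last first.
  by rewrite lte_add_pinfty.
apply: lime_le; first by apply: is_cvg_nneseries => *; exact: outer_measure_ge0.
apply: nearW => N; rewrite big_mkord.
have [A [B [h _ _]]] := sum_bands X N; apply: le_trans h _.
by apply: leeD; exact: le_outer_measure.
Qed.

Let bands_cover X N :
  X `&` [set x | a < f x] `<=` (X `&` [set x | level N.+1 <= f x]) `|`
    \bigcup_(k in ~` `I_N) band X k.
Proof.
move=> x [Xx /= ax]; have [fN|fN] := leP (level N.+1) (f x); first by left; split.
right; have ex : exists j, level j <= f x.
  exists (Num.bound (f x - a)^-1); rewrite -lerBrDl.
  have d0 : 0 < f x - a by rewrite subr_gt0.
  rewrite -[leRHS]invrK lef_pV2 ?posrE ?invr_gt0//.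
  apply/ltW/(lt_le_trans (archi_boundP (ltW _))); first by rewrite invr_gt0.
  by rewrite ler_nat.
have lev_le i j : (i <= j)%N -> level j <= level i.
  by move=> ij; rewrite lerD2l lef_pV2 ?posrE// ler_nat.
have := ex_minnP ex.
case=> j jf jmin.
have Nj : (N.+1 < j)%N.
  rewrite ltnNge; apply/negP => jN.
  by have := le_lt_trans (le_trans (lev_le _ _ jN) jf) fN; rewrite ltxx.
case: j Nj jf jmin => [//|[//|j]] Nj jf jmin.
exists j; first by rewrite !ltnS in Nj; apply/negP; rewrite -leqNgt.
split => //=; rewrite jf/= ltNge; apply/negP => /jmin.
by rewrite ltnn.
Qed.

(** Caratheodory's criterion: if an outer measure of finite total mass is
    additive on sets that are separated by two levels of [f], then the sublevel
    sets of [f] are measurable. *)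
Lemma caratheodory_sublevel : mu.-caratheodory [set x | f x <= a].
Proof.
apply: le_caratheodory_measurable => X.
have tail := @nneseries_tail_cvg _ (fun k => mu (band X k)) xpredT
  (bands_summable X) (fun _ _ => outer_measure_ge0 _ _).
have : (fun N => mu X + \sum_(N <= k <oo) mu (band X k))%E @ \oo -->
    (mu X + 0)%E.
  apply: cvgeD => //; last exact: cvg_cst.
  by rewrite fin_num_adde_defl.
rewrite adde0 => lim.
rewrite -(cvg_lim _ lim)//; apply: lime_ge; first by apply/cvg_ex; exists (mu X).
apply: nearW => N.
have -> : X `&` ~` [set x | f x <= a] = X `&` [set x | a < f x].
  by congr (_ `&` _); apply/seteqP; split => x /=; rewrite ltNge => /negP.
have h1 := le_outer_measure mu _ _ (bands_cover N (X := X)).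
have h2 := le_trans h1 (outer_measureU2 mu _ _).
have h3 := le_trans h2 (leeD2l _ (outer_measure_sigma_subadditive_tail mu N _)).
apply: le_trans (leeD2l _ h3) _; rewrite addeA leeD2r//.
have la : a < level N.+1 by rewrite ltrDl invr_gt0.
apply: (le_trans (muf la _ _)) => [x [_ //]|x [_ //]|].
by apply: le_outer_measure => x [[]|[]].
Qed.


End caratheodory_criterion.

(** * From an outer measure to a Borel probability *)

Section outer_measure_probability.
Variables (R : realType) (n : nat) (mu : {outer_measure set (Hyp R n) -> \bar R}).
Hypothesis mu_open : forall U : set (Hyp R n), open U -> mu.-caratheodory U.
Hypothesis mu1 : mu setT = 1%E.

Let nu (A : set (Hyp R n)) : \bar R := mu A.

Let borel_caratheodory : measurable `<=` mu.-caratheodory.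
Proof.
apply: smallest_sub; last by move=> U; exact: mu_open.
split.
- exact: caratheodory_measurable_set0.
- by move=> A mA; rewrite setTD; exact: caratheodory_measurable_setC.
- by move=> A mA; exact: caratheodory_measurable_bigcup.
Qed.

Let nu0 : nu set0 = 0%E. Proof. exact: outer_measure0. Qed.

Let nu_ge0 A : (0 <= nu A)%E. Proof. exact: outer_measure_ge0. Qed.

Let nu_sigma_additive : semi_sigma_additive nu.
Proof.
move=> A mA tA mUA; apply: caratheodory_measure_sigma_additive => //.
  by move=> i; apply: borel_caratheodory; exact: mA.
exact: borel_caratheodory.
Qed.

HB.instance Definition _ := isMeasure.Build _ _ _ nu
  nu0 nu_ge0 nu_sigma_additive.

HB.instance Definition _ := Measure_isProbability.Build _ _ _ nu mu1.

(** An outer measure of total mass 1 for which open sets are measurable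
    restricts to a Borel probability. *)
Lemma outer_measure_probability :
  exists m : probability (Hyp R n) R, forall A, m A = mu A.
Proof. by exists nu. Qed.

End outer_measure_probability.

Section cover_outer_measure.
Variables (R : realType) (n : nat) (lam : set (Hyp R n) -> R).
Hypothesis lam0 : lam set0 = 0.
Hypothesis lam_ge0 : forall O, 0 <= lam O.
Hypothesis lamD : forall O G H, open O -> open G -> open H -> G `&` H = set0 ->
  lam (O `&` G) + lam (O `&` H) <= lam O.

(* [mu_ext] ranges over measurable covers; the value +oo discards those whose
   members are not all open *)
Let weight (O : set (Hyp R n)) : \bar R :=
  if `[< open O >] then (lam O)%:E else +oo%E.

Let weight0 : weight set0 = 0%E.
Proof. by rewrite /weight asboolT ?lam0//; exact: open0. Qed.

Let weight_ge0 O : (0 <= weight O)%E.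
Proof. by rewrite /weight; case: ifP => // _; rewrite lee_fin. Qed.

(** The infimum of the total mass of countable covers by open sets. *)
Definition cover_ext : set (Hyp R n) -> \bar R := mu_ext weight.

HB.instance Definition _ := isOuterMeasure.Build R (Hyp R n) cover_ext
  (mu_ext0 weight0 weight_ge0) (mu_ext_ge0 weight_ge0)
  (@le_mu_ext _ _ _ weight) (mu_ext_sigma_subadditive weight_ge0).

(** [cover_ext] packed as an outer measure. *)
Definition cover_outer_measure : {outer_measure set (Hyp R n) -> \bar R} :=
  cover_ext.

Let weight_open O : open O -> weight O = (lam O)%:E.
Proof. by move=> oO; rewrite /weight asboolT. Qed.

Lemma cover_ext_le O : open O -> (cover_ext O <= (lam O)%:E)%E.
Proof.
move=> oO; apply: ereal_inf_lbound.
exists (fun k => if k is 0%N then O else set0).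
  split; first by case=> [|k]; [exact: open_measurable_hyp|exact: measurable0].
  by move=> x Ox; exists 0%N.
rewrite nneseries_recl//.
rewrite eseries_cond eseries0 ?adde0 ?weight_open// => -[|k]//= _ _.
Qed.

Lemma cover_ext_ge (A : set (Hyp R n)) (t : \bar R) :
  (forall O : nat -> set (Hyp R n), (forall k, open (O k)) ->
    A `<=` \bigcup_k O k -> t <= \sum_(0 <= k <oo) (lam (O k))%:E)%E ->
  (t <= cover_ext A)%E.
Proof.
move=> h; apply: le_ereal_inf_tmp => _ [C [mC AC] <-].
have [oC|] := pselect (forall k, open (C k)).
  rewrite (eq_eseriesr (fun k _ => weight_open (oC k))); exact: h.
move=> /existsNP[k nok]; rewrite (@eseries_pinfty _ _ _ k) ?leey//.
  by move=> i _; rewrite -ltNye (lt_le_trans _ (weight_ge0 _)).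
by rewrite /weight asboolF.
Qed.

(** Additivity on sets that are separated by disjoint open sets. *)
Lemma cover_extD (G H A B : set (Hyp R n)) : open G -> open H ->
  G `&` H = set0 -> A `<=` G -> B `<=` H ->
  (cover_ext A + cover_ext B <= cover_ext (A `|` B))%E.
Proof.
move=> oG oH GH AG BH; apply: cover_ext_ge => O oO ABO.
have lE i : (0 <= (lam i)%:E)%E by rewrite lee_fin.
apply: (@le_trans _ _ (\sum_(0 <= k <oo) (lam (O k `&` G))%:E +
    \sum_(0 <= k <oo) (lam (O k `&` H))%:E)%E); last first.
  rewrite -nneseriesD//; apply: lee_nneseries => [i _ _|i _].
    exact: adde_ge0.
  by rewrite -EFinD lee_fin lamD.
have wE G' : open G' -> forall k, weight (O k `&` G') = (lam (O k `&` G'))%:E.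
  by move=> oG' k; apply: weight_open; exact: openI.
rewrite -(eq_eseriesr (fun k _ => wE _ oG k)).
rewrite -(eq_eseriesr (fun k _ => wE _ oH k)).
apply: leeD; apply: ereal_inf_lbound.
  exists (fun k => O k `&` G) => //; split.
    by move=> k; apply: open_measurable_hyp; exact: openI.
  move=> x Ax; have [k _ Okx] : (\bigcup_k O k) x by apply: ABO; left.
  by exists k => //; split => //; exact: AG.
exists (fun k => O k `&` H) => //; split.
  by move=> k; apply: open_measurable_hyp; exact: openI.
move=> x Bx; have [k _ Okx] : (\bigcup_k O k) x by apply: ABO; right.
by exists k => //; split => //; exact: BH.
Qed.

(** The coordinates satisfy the hypothesis of [caratheodory_sublevel], and open
    sets are generated by the coordinates. *)
Lemma cover_ext_caratheodory (U : set (Hyp R n)) :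
  (cover_ext setT < +oo)%E -> open U -> cover_ext.-caratheodory U.
Proof.
move=> fin; case=> V oV <-.
have mcoord i : measurable_fun setT
    (fun x : caratheodory_type cover_ext => \val x ord0 i : R).
  apply: (measurability _ (RGenOInfty.measurableE R)) => _ [_ [a ->] <-].
  rewrite setTI; have -> : (fun x : Hyp R n => \val x ord0 i) @^-1` `]a, +oo[ =
      ~` [set x : Hyp R n | \val x ord0 i <= a].
    apply/seteqP; split => x /=; rewrite in_itv/= andbT ltNge.
      by move/negP.
    by move/negP.
  apply: caratheodory_measurable_setC; apply: caratheodory_sublevel => //.
  move=> b c A B bc Ab Bc.
  pose d := (b + c) / 2; have bd : b < d by rewrite /d; lra.
  have dc : d < c by rewrite /d; lra.
  pose p (x : Hyp R n) : R := \val x ord0 i.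
  apply: (@cover_extD (p @^-1` [set t | t < d]) (p @^-1` [set t | d < t])).
  - by apply: open_comp; [move=> x _; exact: continuous_hcoord|exact: open_lt].
  - by apply: open_comp; [move=> x _; exact: continuous_hcoord|exact: open_gt].
  - apply/seteqP; split => x //= -[xd dx].
    by have := lt_trans xd dx; rewrite ltxx.
  - by move=> x Ax; exact: le_lt_trans (Ab _ Ax) bd.
  - by move=> x Bx; exact: lt_le_trans dc (Bc _ Bx).
exact: (@measurable_preimage_rV _ (caratheodory_type cover_ext) R n.+1
  (fun x => \val x) V mcoord oV).
Qed.

End cover_outer_measure.

(** * Weak limits of tight families *)

(** Bounded real families converge along an ultrafilter, by compactness. *)
Lemma ultra_cvg_bounded (R : realType) (I : Type) (U : set_system I)
    (f : I -> R) (a b : R) : UltraFilter U ->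
  (forall i, a <= f i <= b) -> exists l : R, f @ U --> l.
Proof.
move=> UU fab.
have UP : ProperFilter U by exact: ultra_proper.
have fU : (f @ U) `[a, b]%classic.
  have : \forall i \near U, a <= f i <= b by exact: filterE.
  by apply: filterS => i; rewrite /= in_itv.
have [l [_ fl]] := segment_compact (fmap_proper_filter f UP) fU.
exists l => B Bl.
have [//|UB] := in_ultra_setVsetC (f @^-1` B) UU.
have [|y []] := fl (~` B) B _ Bl; first exact: UB.
by move=> nB yB.
Qed.

Section weak_limit.
Variables (R : realType) (n : nat) (I : Type) (U : set_system I).
Variable mk : I -> probability (Hyp R n) R.
Hypothesis UU : UltraFilter U.
Hypothesis tight : forall e : R, 0 < e -> exists r : R, \forall k \near U,
  ((1 - e)%:E <= mk k [set x | hdist x (vertex R n) <= r]%R)%E.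

(** A tight family of probabilities has, along an ultrafilter, a limit for
    which the measure of open sets is lower semicontinuous. *)
Lemma tight_weak_limit : exists m : probability (Hyp R n) R,
  forall O, open O -> le_liminf U (m O) (fun k => mk k O).
Proof.
have UP : ProperFilter U by exact: ultra_proper.
have /choice[lam lamP] : forall O, exists l : R,
    0 <= l /\ (measurable O -> fine (mk k O) @[k --> U] --> l).
  move=> O; have [mO|nO] := pselect (measurable O); last by exists 0.
  have h k : 0 <= fine (mk k O) <= 1.
    by rewrite fine_ge0//= -lee_fin fineK ?fin_num_measure// probability_le1.
  have [l fl] := ultra_cvg_bounded UU h.
  exists l; split => //; apply: (cvgr_to_ge fl).
  by apply: filterE => k; have /andP[] := h k.
have lam_ge0 O : 0 <= lam O by have [] := lamP O.
have lam_cvg O : open O -> fine (mk k O) @[k --> U] --> lam O.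
  by move=> oO; have [_] := lamP O; apply; exact: open_measurable_hyp.
have lam0 : lam set0 = 0.
  have := lam_cvg _ open0; under eq_cvg do rewrite measure0.
  by move/(cvg_unique _); apply => //; exact: cvg_cst.
have lamD O G H : open O -> open G -> open H -> G `&` H = set0 ->
    lam (O `&` G) + lam (O `&` H) <= lam O.
  move=> oO oG oH GH.
  have oOG := openI oO oG; have oOH := openI oO oH.
  have mOG := open_measurable_hyp oOG; have mOH := open_measurable_hyp oOH.
  have mO := open_measurable_hyp oO.
  rewrite -subr_ge0.
  apply: (cvgr_to_ge (cvgB (lam_cvg _ oO) (cvgD (lam_cvg _ oOG) (lam_cvg _ oOH)))).
  apply: filterE => k; rewrite subr_ge0.
  rewrite -lee_fin EFinD !fineK ?fin_num_measure//.
  rewrite -measureU//; last by rewrite setIACA setIid GH setI0.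
  by apply: le_measure; rewrite ?inE//; [exact: measurableU|move=> x [[]|[]]].
have lam1 : lam setT = 1.
  have := lam_cvg _ openT; under eq_cvg do rewrite probability_setT.
  by move/(cvg_unique _); apply => //; exact: cvg_cst.
have mu1 : cover_ext lam setT = 1%E.
  apply/eqP; rewrite eq_le; apply/andP; split.
    by rewrite -[leRHS]/(1%:E) -lam1; apply: cover_ext_le => //; exact: openT.
  apply: cover_ext_ge => // C oC CT; apply/lee_addgt0Pr => e e0.
  have [r hr] := tight e0.
  have mC i : measurable (C i) by exact: open_measurable_hyp.
  have mB : measurable [set x : Hyp R n | hdist x (vertex R n) <= r].
    exact: measurable_hdist_le.
  have := @compact_hball R n r; rewrite compact_cover => cB.
  have [||D _ DB] := cB nat setT C.
  - by move=> i _; exact: oC.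
  - by move=> x _; have [i _ ?] := CT x Logic.I; exists i.
  (* a finite subcover is contained in an initial segment of the cover *)
  pose N := (\max_(i <- finmap.enum_fset D) i).+1.
  have BN : [set x | hdist x (vertex R n) <= r] `<=` \big[setU/set0]_(i < N) C i.
    move=> x /DB [i /= iD Cx]; rewrite -bigcup_mkord; exists i => //=.
    by rewrite ltnS; apply: leq_bigmax_seq.
  have lamN : 1 - e <= \sum_(i < N) lam (C i).
    have cN : (\sum_(i < N) fine (mk k (C i))) @[k --> U] --> \sum_(i < N) lam (C i).
      apply: cvg_big => [|i _]; first exact: add_continuous.
      exact: lam_cvg.
    apply: (cvgr_to_ge cN); apply: filterS hr => k kr.
    rewrite -lee_fin -sumEFin; apply: le_trans kr _.
    under eq_bigr => i _ do rewrite fineK ?fin_num_measure//.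
    exact: content_subadditive.
  apply: (@le_trans _ _ ((1 - e)%:E + e%:E)%E); first by rewrite -EFinD subrK.
  rewrite leeD2r//; apply: (@le_trans _ _ (\sum_(i < N) lam (C i))%:E).
    by rewrite lee_fin.
  rewrite -sumEFin -(big_mkord xpredT (fun i => (lam (C i))%:E)).
  by apply: nneseries_lim_ge => i _ _; rewrite lee_fin.
have muo O : open O -> (cover_ext lam).-caratheodory O.
  by apply: cover_ext_caratheodory => //; rewrite mu1 ltry.
have [m mE] := @outer_measure_probability R n
  (cover_outer_measure lam0 lam_ge0) muo mu1.
exists m => O oO t; rewrite mE => /lt_le_trans.
move=> /(_ _ (cover_ext_le lam0 lam_ge0 oO)); rewrite lte_fin => tO.
have /cvgr_gt/(_ _ tO) := lam_cvg _ oO; apply: filterS => k /=.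
by rewrite -lte_fin fineK// fin_num_measure//; exact: open_measurable_hyp.
Qed.


End weak_limit.

(** * Interaction of two sets *)

Section conditional.
Context d (T : measurableType d) (R : realType).
Variables (P : probability T R) (A : set T).
Hypotheses (mA : measurable A) (PA : (0 < P A)%E).
Local Open Scope ereal_scope.

(** Conditioning on an event of positive probability, described by its effect
    on integrals. *)
Lemma conditional_probability : exists Q : probability T R,
  forall g : T -> \bar R, measurable_fun setT g -> (forall x, 0 <= g x) ->
    \int[Q]_x g x = (fine (P A))^-1%:E * \int[P]_(x in A) g x.
Proof.
have PAfin : P A \is a fin_num by exact: fin_num_measure.
have PA0 : (0 < fine (P A))%R by rewrite -lte_fin fineK.
exists (mnormalize (mrestr P mA) P) => g mg g0.
have c0 : (0 <= (fine (P A))^-1)%R by rewrite invr_ge0 ltW.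
pose c : {nonneg R} := NngNum c0.
have QE B : mnormalize (mrestr P mA) P B = c%:num%:E * P (B `&` A).
  rewrite /mnormalize/= /mrestr setTI gt_eqF// lt_eqF ?ltey_eq ?PAfin//=.
  by rewrite muleC.
rewrite -(setUv A) ge0_integral_setU//=; last 3 first.
- exact: measurableC.
- by rewrite setUv.
- by apply/disj_setPS => x [].
rewrite [X in _ + X](_ : _ = 0) ?adde0; last first.
  rewrite -(integral_measure_zero (~` A) g); apply: eq_measure_integral => B mB BA.
  rewrite [LHS]QE (_ : B `&` A = set0) ?measure0 ?mule0//.
  by apply/seteqP; split => x // -[/BA].
rewrite -[X in X%:E * _]/(c%:num) -ge0_integral_mscale//; last exact: measurable_funTS.
apply: eq_measure_integral => B mB BA.
by rewrite [LHS]QE (setIidl BA).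
Qed.

End conditional.

Section interaction.
Context d (T : measurableType d) (R : realType).
Variable F : T * T -> \bar R.
Hypotheses (mF : measurable_fun setT F) (F0 : forall p, (0 <= F p)%E).
Local Open Scope ereal_scope.
Implicit Types (P Q : probability T R) (A B C : set T).

(** The double integral of [F] over [A `*` B]. *)
Definition interaction P A B : \bar R := \int[P]_(x in A) \int[P]_(y in B) F (x, y).

Lemma measurable_section x : measurable_fun setT (fun y => F (x, y)).
Proof. by apply: measurableT_comp => //; exact: measurable_pair1. Qed.

Lemma measurable_inner P B : measurable B ->
  measurable_fun setT (fun x => \int[P]_(y in B) F (x, y)).
Proof.
move=> mB; under eq_fun do rewrite integral_mkcond.
have mFB : measurable_fun setT (F \_ (setT `*` B)).
  apply/measurable_restrict => //; first exact: measurableX.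
  by rewrite setTI; exact: measurable_funTS.
have := @measurable_fun_fubini_tonelli_F _ _ _ _ _ P _ mFB
  (fun p => erestrict_ge0 (fun p _ => F0 p) p).
congr measurable_fun; apply/funext => x; apply: eq_integral => y _.
by rewrite !patchE/= in_setX in_setT.
Qed.

Lemma inner_ge0 P B x : 0 <= \int[P]_(y in B) F (x, y).
Proof. exact: integral_ge0. Qed.

Lemma interaction_ge0 P A B : 0 <= interaction P A B.
Proof. by apply: integral_ge0 => x _; exact: inner_ge0. Qed.

Lemma integral_interaction P :
  \int[P \x P]_p F p = interaction P setT setT.
Proof. exact: fubini_tonelli1. Qed.

Lemma interactionUl P A B C : measurable A -> measurable B -> measurable C ->
  [disjoint A & B] ->
  interaction P (A `|` B) C = interaction P A C + interaction P B C.
Proof.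
move=> mA mB mC AB; rewrite /interaction ge0_integral_setU//.
  by apply: measurable_funTS; exact: measurable_inner.
by move=> x _; exact: inner_ge0.
Qed.

Lemma interactionUr P A B C : measurable A -> measurable B -> measurable C ->
  [disjoint B & C] ->
  interaction P A (B `|` C) = interaction P A B + interaction P A C.
Proof.
move=> mA mB mC BC; rewrite /interaction -ge0_integralD//.
- apply: eq_integral => x _; rewrite ge0_integral_setU//.
  by apply: measurable_funTS; exact: measurable_section.
- by move=> x _; exact: inner_ge0.
- by apply: measurable_funTS; exact: measurable_inner.
- by move=> x _; exact: inner_ge0.
- by apply: measurable_funTS; exact: measurable_inner.
Qed.

Lemma le_interaction P A B C : measurable A -> measurable B -> measurable C ->
  A `<=` B -> interaction P A C <= interaction P B C.
Proof.
move=> mA mB mC AB; apply: ge0_subset_integral => //.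
  by apply: measurable_funTS; exact: measurable_inner.
by move=> x _; exact: inner_ge0.
Qed.

Lemma le_interactionr P A B C : measurable A -> measurable B -> measurable C ->
  B `<=` C -> interaction P A B <= interaction P A C.
Proof.
move=> mA mB mC BC; apply: ge0_le_integral => //.
- by move=> x _; exact: inner_ge0.
- by apply: measurable_funTS; exact: measurable_inner.
- by apply: measurable_funTS; exact: measurable_inner.
- move=> x _; apply: ge0_subset_integral => //.
  by apply: measurable_funTS; exact: measurable_section.
Qed.

Lemma interaction_ge P A B (a : R) : measurable A -> measurable B -> (0 <= a)%R ->
  (forall x y, A x -> B y -> a%:E <= F (x, y)) ->
  a%:E * (P A * P B) <= interaction P A B.
Proof.
move=> mA mB a0 aF.
apply: (@le_trans _ _ (\int[P]_(x in A) (a%:E * P B))).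
  by rewrite integral_cst// muleAC muleA.
apply: ge0_le_integral => //.
- by move=> x _; rewrite mule_ge0.
- by apply: measurable_funTS; exact: measurable_inner.
move=> x Ax; rewrite -integral_cst//; apply: ge0_le_integral => //.
- by apply: measurable_funTS; exact: measurable_section.
- by move=> y By; exact: aF.
Qed.

(** Comparison with the probability conditioned on [A]. *)
Lemma interaction_self_ge P A (J0 : R) : measurable A ->
  (forall Q, J0%:E <= \int[Q \x Q]_p F p) ->
  J0%:E * (P A * P A) <= interaction P A A.
Proof.
move=> mA hJ; have [PA0|PA0] := eqVneq (P A) 0.
  by rewrite PA0 !mule0 interaction_ge0.
have PA : 0 < P A by rewrite lt0e PA0/=.
have PAfin : P A \is a fin_num by exact: fin_num_measure.
have pa : (0 < fine (P A))%R by rewrite -lte_fin fineK.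
have [Q QE] := conditional_probability mA PA.
have := hJ Q; rewrite integral_interaction /interaction.
under eq_integral do rewrite (QE _ (measurable_section _)) //.
rewrite ge0_integralZl//; last 3 first.
- exact: measurable_inner.
- by move=> x _; exact: inner_ge0.
- by rewrite lee_fin invr_ge0 ltW.
rewrite QE; last 2 first.
- exact: measurable_inner.
- by move=> x; exact: inner_ge0.
rewrite -/(interaction P A A) muleA -EFinM -invfM -(fineK PAfin) -!EFinM.
move: (interaction_ge0 P A A); case: (interaction P A A) => [s| |]// _.
  by rewrite -EFinM !lee_fin ler_pdivlMl ?mulr_gt0// mulrC.
by move=> _; exact: leey.
Qed.

(** If [J0] bounds all double integrals from below and [P] attains it up to [e],
    then the mean interaction between a set and its complement is at most [J0],
    up to [e]. *)
Lemma interaction_compl_le P A (J0 e : R) : measurable A ->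
  (forall Q, J0%:E <= \int[Q \x Q]_p F p) ->
  \int[P \x P]_p F p <= (J0 + e)%:E ->
  interaction P A (~` A) + interaction P (~` A) A <=
    (2 * J0 * (fine (P A) * (1 - fine (P A))) + e)%:E.
Proof.
move=> mA hJ; rewrite integral_interaction -(setUv A).
have mAC := measurableC mA.
have dA : [disjoint A & ~` A] by apply/disj_setPS => x [].
rewrite interactionUl//; [|by rewrite setUv..].
rewrite !interactionUr//.
have := interaction_self_ge P mA hJ; have := interaction_self_ge P mAC hJ.
rewrite probability_setC//.
have -> : P A = (fine (P A))%:E by rewrite fineK// fin_num_measure.
move: (fine _) => m.
move: (interaction_ge0 P A (~` A)) (interaction_ge0 P (~` A) A).
move: (interaction_ge0 P A A) (interaction_ge0 P (~` A) (~` A)).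
case: (interaction P A A) => [s| |]//; case: (interaction P (~` A) (~` A)) => [t| |]//;
case: (interaction P A (~` A)) => [u| |]//; case: (interaction P (~` A) A) => [w| |]//.
rewrite /= -EFinB -!EFinM -!EFinD !lee_fin /=; lra.
Qed.

End interaction.

(** * Concentration of near minimizers *)

Section concentration.
Variables (R : realType) (n : nat) (F : Hyp R n * Hyp R n -> \bar R).
Hypotheses (mF : measurable_fun setT F) (F0 : forall p, (0 <= F p)%E).
Variables (a L J0 : R).
Hypotheses (L0 : 0 < L) (J00 : 0 <= J0) (J0a : J0 < a).
Hypothesis F_far : forall x y, L <= hdist x y -> (a%:E <= F (x, y))%E.
Hypothesis F_inf :
  forall Q : probability (Hyp R n) R, (J0%:E <= \int[Q \x Q]_p F p)%E.
Implicit Types (P : probability (Hyp R n) R) (x : Hyp R n) (r e : R).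

Let a0 : 0 < a. Proof. exact: le_lt_trans J0a. Qed.

Let hball x r : set (Hyp R n) := [set y | hdist y x < r].

Let mhball x r : measurable (hball x r).
Proof. exact: measurable_hdist_lt. Qed.

(** The mass of the open ball of radius [r] around [x]. *)
Definition ball_mass P x r : R := fine (P (hball x r)).

Lemma ball_massE P x r : P (hball x r) = (ball_mass P x r)%:E.
Proof. by rewrite fineK// fin_num_measure. Qed.

Lemma ball_mass_ge0 P x r : 0 <= ball_mass P x r.
Proof. exact: fine_ge0. Qed.

Lemma ball_mass_le1 P x r : ball_mass P x r <= 1.
Proof. by rewrite -lee_fin fineK ?fin_num_measure// probability_le1. Qed.

Lemma le_ball_mass P x r r' : r <= r' -> ball_mass P x r <= ball_mass P x r'.
Proof.
move=> rr'; rewrite -lee_fin !fineK ?fin_num_measure//.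
apply: le_measure; rewrite ?inE//; [exact: mhball..|].
by move=> y /lt_le_trans; exact.
Qed.

(** The ball of radius [r] is at distance at least [L] from the complement of
    the ball of radius [r + L]. *)
Lemma ball_mass_step P x r e : (\int[P \x P]_p F p <= (J0 + e)%:E)%E ->
  a * (ball_mass P x r * (1 - ball_mass P x (r + L))) <=
  J0 * (ball_mass P x (r + L) * (1 - ball_mass P x (r + L))) + e / 2.
Proof.
move=> PF; have mA := mhball x (r + L); have mB := mhball x r.
have mAC := measurableC mA.
have BA : hball x r `<=` hball x (r + L).
  by move=> y /=; rewrite /hball/= => h; apply: lt_trans h _; rewrite ltrDl.
have far y z : hball x r y -> (~` hball x (r + L)) z ->
    (a%:E <= F (y, z))%E /\ (a%:E <= F (z, y))%E.
  rewrite /hball/= => yr /negP; rewrite -leNgt => zr.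
  have tri := hdist_triangle z y x; have d := hdistC y z.
  by split; apply: F_far; lra.
have := interaction_compl_le mF F0 mA F_inf PF.
have i1 := le_trans (interaction_ge mF F0 P mB mAC (ltW a0)
  (fun y z hy hz => proj1 (far y z hy hz))) (le_interaction mF F0 P mB mA mAC BA).
have i2 := le_trans (interaction_ge mF F0 P mAC mB (ltW a0)
  (fun z y hz hy => proj2 (far y z hy hz))) (le_interactionr mF F0 P mAC mB mA BA).
move/(le_trans (leeD i1 i2)).
rewrite probability_setC// !ball_massE /= -EFinB -!EFinM -EFinD lee_fin; lra.
Qed.

(** Every probability whose double integral is close enough to [J0] has a ball
    of radius [L] of at least this mass, see [exists_center]. *)
Definition concentration : R := (a - J0) / (2 * a).

Lemma concentration_gt0 : 0 < concentration.
Proof. by rewrite divr_gt0 ?subr_gt0// mulr_gt0. Qed.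

Lemma exists_center P e : e < (a - J0) / 2 ->
  (\int[P \x P]_p F p <= (J0 + e)%:E)%E ->
  exists x, concentration <= ball_mass P x L.
Proof.
move=> e_small PF; apply/not_existsP => h; move: PF; apply/negP.
rewrite -ltNge integral_interaction//.
have lower : (((a + J0) / 2)%:E <= interaction F P setT setT)%E.
  rewrite -[leLHS]mule1 -(probability_setT P) -integral_cst//.
  apply: ge0_le_integral => //.
  - by move=> x _; rewrite lee_fin divr_ge0// addr_ge0// ltW.
  - exact: measurable_inner.
  move=> x _; have mC := measurableC (mhball x L).
  apply: (@le_trans _ _ (\int[P]_(y in ~` hball x L) F (x, y))%E); last first.
    apply: ge0_subset_integral => //; exact: measurable_section.
  apply: (@le_trans _ _ (\int[P]_(y in ~` hball x L) a%:E)%E); last first.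
    apply: ge0_le_integral => //.
    - by move=> y _; rewrite lee_fin ltW.
    - by apply: measurable_funTS; exact: measurable_section.
    - move=> y /negP; rewrite -leNgt => yL; apply: F_far.
      by rewrite hdistC.
  rewrite integral_cst// [X in (_ * X)%E](_ : _ = (1 - ball_mass P x L)%:E);
    last by rewrite EFinB -ball_massE; exact: probability_setC.
  rewrite -EFinM lee_fin.
  have : ball_mass P x L <= concentration by rewrite leNgt; apply/negP => /ltW /h.
  rewrite -(ler_pM2l a0) /concentration.
  have -> : a * ((a - J0) / (2 * a)) = (a - J0) / 2 by field; rewrite gt_eqF.
  lra.
apply: lt_le_trans lower; rewrite lte_fin; lra.
Qed.

Let radius (N : nat) : R := N.+1%:R * L.

Let radiusS N : radius N.+1 = radius N + L.
Proof. by rewrite /radius -[in LHS]natr1; ring. Qed.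

Let radius_ge N : L <= radius N.
Proof. by rewrite /radius ler_peMl ?ler1n// ltW. Qed.

(** Near minimizers are tight around their centers: the bound on the mass
    outside a ball comes from adding [ball_mass_step] over the first [N]
    multiples of [L], where the increments of [ball_mass] telescope. *)
Lemma ball_mass_compl_le P x e N : (\int[P \x P]_p F p <= (J0 + e)%:E)%E ->
  0 <= e -> concentration <= ball_mass P x L ->
  N%:R * ((a - J0) * concentration * (1 - ball_mass P x (radius N))) <=
  a + N%:R * (e / 2).
Proof.
move=> PF e0 xL.
suff : N%:R * ((a - J0) * concentration * (1 - ball_mass P x (radius N))) <=
    a * ball_mass P x (radius N) + N%:R * (e / 2).
  move/le_trans; apply; rewrite lerD2r -[leRHS]mulr1 ler_pM2l//.
  exact: ball_mass_le1.
have c0 := concentration_gt0.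
elim: N => [|N IH]; first by rewrite !mul0r addr0 mulr_ge0 ?ball_mass_ge0// ltW.
have := ball_mass_step x (radius N) PF; rewrite -radiusS.
have : concentration <= ball_mass P x (radius N.+1).
  by apply: le_trans xL _; apply: le_ball_mass; exact: radius_ge.
have mono : ball_mass P x (radius N) <= ball_mass P x (radius N.+1).
  by apply: le_ball_mass; rewrite radiusS lerDl ltW.
have := ball_mass_le1 P x (radius N.+1); have := ball_mass_ge0 P x (radius N).
move: IH mono; rewrite -(natr1 N).
move: (ball_mass P x (radius N)) (ball_mass P x (radius N.+1)) => p q.
have : 0 <= N%:R :> R by [].
move: (N%:R) concentration c0 => k c c0 k0 IH pq p0 q1 cq h.
have aJ : 0 < a - J0 by rewrite subr_gt0.
have h1 : k * ((a - J0) * c * (1 - q)) <= k * ((a - J0) * c * (1 - p)).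
  by apply: ler_wpM2l => //; apply: ler_wpM2l; [rewrite mulr_ge0// ltW|lra].
have h2 : (a - J0) * c * (1 - q) <= a * (q - p) + e / 2.
  have : (a - J0) * (1 - q) * c <= (a - J0) * (1 - q) * q.
    by apply: ler_wpM2l => //; rewrite mulr_ge0 ?subr_ge0// ltW.
  have : a * (q - p) * (1 - q) <= a * (q - p) * 1.
    by apply: ler_wpM2l; [rewrite mulr_ge0 ?subr_ge0// ltW|lra].
  lra.
lra.
Qed.

(** Minimizers live in a ball of controlled radius around their centers: as long
    as the mass outside the ball is positive, [ball_mass_step] can be divided by
    it, so each step of length [L] adds a fixed mass. *)
Lemma ball_mass_eq1 P x N : (\int[P \x P]_p F p <= J0%:E)%E ->
  concentration <= ball_mass P x L -> a < N%:R * ((a - J0) * concentration) ->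
  ball_mass P x (radius N) = 1.
Proof.
move=> PF xL aN.
have PF0 : (\int[P \x P]_p F p <= (J0 + 0)%:E)%E by rewrite addr0.
apply/eqP; rewrite eq_le ball_mass_le1/= leNgt; apply/negP => lt1.
suff : N%:R * ((a - J0) * concentration) <= a * ball_mass P x (radius N).
  by have := ball_mass_le1 P x (radius N); rewrite -(ler_pM2l a0) mulr1; lra.
elim: N lt1 {aN} => [|N IH] lt1.
  by rewrite mul0r mulr_ge0 ?ball_mass_ge0// ltW.
have mono : ball_mass P x (radius N) <= ball_mass P x (radius N.+1).
  by apply: le_ball_mass; rewrite radiusS lerDl ltW.
have {}IH := IH (le_lt_trans mono lt1).
have h : a * ball_mass P x (radius N) <= J0 * ball_mass P x (radius N.+1).
  have := ball_mass_step x (radius N) PF0; rewrite -radiusS mul0r addr0 !mulrA.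
  by rewrite ler_pM2r ?subr_gt0.
have : concentration <= ball_mass P x (radius N.+1).
  by apply: le_trans xL _; apply: le_ball_mass; exact: radius_ge.
rewrite -(@ler_pM2l _ (a - J0)) ?subr_gt0// => h'.
rewrite -(natr1 N); lra.
Qed.

End concentration.

(** * Recentering and lower bounds *)

Section isometry_invariance.
Variables (R : realType) (n : nat) (F : Hyp R n * Hyp R n -> \bar R).
Hypotheses (mF : measurable_fun setT F) (F0 : forall p, (0 <= F p)%E).
Hypothesis F_dist : forall x y x' y', hdist x y = hdist x' y' ->
  F (x, y) = F (x', y').

(** The double integral is invariant under the reflection that exchanges [x]
    and the vertex. *)
Lemma recenter (P : probability (Hyp R n) R) (x : Hyp R n) :
  exists Q : probability (Hyp R n) R,
    (\int[Q \x Q]_p F p = \int[P \x P]_p F p)%E /\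
    forall r, Q [set y | hdist y (vertex R n) < r] = P [set y | hdist y x < r].
Proof.
pose phi : {mfun Hyp R n >-> Hyp R n} :=
  HB.pack (hrefl x) (isMeasurableFun.Build _ _ _ _ _ (measurable_hrefl x)).
exists (distribution P phi); split; last first.
  move=> r; rewrite /distribution /pushforward; congr (P _).
  apply/seteqP; split => y /=; by rewrite -{1}(hrefl_center x) hdist_hrefl.
rewrite !integral_interaction// /interaction.
rewrite ge0_integral_pushforward//; last 2 first.
- exact: (measurable_inner mF F0 (distribution P phi) measurableT).
- by move=> y _; exact: inner_ge0.
apply: eq_integral => y _ /=.
rewrite ge0_integral_pushforward//; last first.
  exact: (measurable_section mF).
by apply: eq_integral => z _ /=; apply: F_dist; exact: hdist_hrefl.
Qed.

End isometry_invariance.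

(** Subtracting a lower bound commutes with integration against a probability,
    even when the integral is infinite. *)
Lemma integralB_lower_bound d (T : measurableType d) (R : realType)
    (P : probability T R) (g : T -> \bar R) (c : R) : c <= 0 ->
  measurable_fun setT g -> (forall x, (c%:E <= g x)%E) ->
  (\int[P]_x g x = \int[P]_x (g x - c%:E) + c%:E)%E.
Proof.
move=> c0 mg cg.
have mgc : measurable_fun setT (fun x => (g x - c%:E)%E).
  by have := emeasurable_funB mg (measurable_cst c%:E).
have gc0 x : (0 <= g x - c%:E)%E by rewrite sube_ge0.
(* the decomposition in positive and negative parts, written so that only
   nonnegative functions are integrated *)
have split_int : (\int[P]_x (g x - c%:E) + \int[P]_x g^\- x =
    \int[P]_x g^\+ x + (- c)%:E)%E.
  have -> : (- c)%:E = (\int[P]_x (- c)%:E)%E.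
    by rewrite integral_cst// [X in (_ * X)%E](_ : _ = 1%E) ?mule1//;
      exact: probability_setT.
  rewrite -!ge0_integralD//.
  - apply: eq_integral => x _; rewrite funenegE funeposE.
    have := cg x; case: (g x) => [r| |]// _.
      rewrite -!EFinN -EFinD -!EFin_max -!EFinD; congr _%:E.
      by rewrite /Num.max; case: ltP => ?; case: ltP => ?; lra.
    by rewrite /= maxye maxNye adde0.
  - exact: measurable_funepos.
  - by move=> x _; rewrite lee_fin; lra.
  - exact: measurable_funeneg.
have neg_le : (\int[P]_x g^\- x <= (- c)%:E)%E.
  have -> : (- c)%:E = (\int[P]_x (- c)%:E)%E.
    by rewrite integral_cst// [X in (_ * X)%E](_ : _ = 1%E) ?mule1//;
      exact: probability_setT.
  apply: ge0_le_integral => //.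
  - exact: measurable_funeneg.
  - by move=> x _; rewrite funenegE ge_max EFinN leeN2 cg /= lee_fin; lra.
have neg_ge0 : (0 <= \int[P]_x g^\- x)%E by exact: integral_ge0.
have pos_ge0 : (0 <= \int[P]_x g^\+ x)%E by exact: integral_ge0.
have gc_ge0 : (0 <= \int[P]_x (g x - c%:E))%E by exact: integral_ge0.
rewrite integralE; move: split_int neg_le neg_ge0 pos_ge0 gc_ge0.
case: (\int[P]_x g^\- x)%E => [s| |]//.
case: (\int[P]_x g^\+ x)%E => [t| |]//; case: (\int[P]_x _)%E => [u| |]//.
by rewrite -!EFinD => -[h] _ _ _ _; congr _%:E; lra.
Qed.

(** * Existence of a minimum *)

Section minimization.
Variables (R : realType) (n : nat) (F : Hyp R n * Hyp R n -> \bar R).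
Hypothesis F0 : forall p, (0 <= F p)%E.
Hypothesis oF : forall t : R, open [set p | (t%:E < F p)%E].
Variables (a L J0 : R).
Hypotheses (L0 : 0 < L) (J00 : 0 <= J0) (J0a : J0 < a).
Hypothesis F_far : forall x y, L <= hdist x y -> (a%:E <= F (x, y))%E.
Hypothesis F_inf :
  forall Q : probability (Hyp R n) R, (J0%:E <= \int[Q \x Q]_p F p)%E.

Let mF : measurable_fun setT F.
Proof.
by apply: measurable_fun_superlevel => t; exact: open_measurable_hyp2.
Qed.

Let conc := concentration a J0.

Let conc0 : 0 < conc. Proof. exact: concentration_gt0. Qed.

Let rate : R := (a - J0) * conc.

Let rate0 : 0 < rate. Proof. by rewrite mulr_gt0// subr_gt0. Qed.

Lemma exists_minimum :
  (forall x y x' y', hdist x y = hdist x' y' -> F (x, y) = F (x', y')) ->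
  (forall e : R, 0 < e -> exists P : probability (Hyp R n) R,
    (\int[P \x P]_p F p <= (J0 + e)%:E)%E) ->
  exists m : probability (Hyp R n) R, (\int[m \x m]_p F p <= J0%:E)%E.
Proof.
move=> F_dist F_approx.
(* any e0 below the threshold (a - J0) / 2 of [exists_center] would do *)
pose e0 := (a - J0) / 4; have e00 : 0 < e0 by rewrite divr_gt0// subr_gt0.
pose e k : R := e0 / k.+1%:R.
have ek0 k : 0 < e k by rewrite divr_gt0.
have /choice[mk mkP] : forall k, exists P : probability (Hyp R n) R,
    (\int[P \x P]_p F p <= (J0 + e k)%:E)%E /\
    conc <= ball_mass P (vertex R n) L.
  move=> k; have [P PF] := F_approx _ (ek0 k).
  have ek_small : e k < (a - J0) / 2.
    apply: (@le_lt_trans _ _ e0); last by rewrite /e0; have := e00; rewrite /e0; lra.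
    by rewrite ler_pdivrMr// ler_peMr ?ler1n// ltW.
  have [x xL] := exists_center mF F0 J00 J0a F_far ek_small PF.
  have [Q [QF QB]] := recenter mF F0 F_dist P x.
  by exists Q; rewrite QF /ball_mass QB.
have [U [UU oU]] := @ultraFilterLemma nat \oo _.
have e_near (t : R) : 0 < t -> \forall k \near U, e k <= t.
  move=> t0; apply: oU; exists (Num.bound (e0 / t)) => // k /= tk.
  rewrite /e ler_pdivrMr// mulrC -ler_pdivrMr//.
  apply/ltW/(lt_le_trans (archi_boundP (ltW (divr_gt0 e00 t0)))).
  by rewrite ler_nat; exact: leq_trans tk _.
have tight (eps : R) : 0 < eps -> exists r : R, \forall k \near U,
    ((1 - eps)%:E <= mk k [set x | hdist x (vertex R n) <= r]%R)%E.
  move=> eps0; have re0 : 0 < rate * eps by rewrite mulr_gt0.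
  (* for this N, both error terms of the tail estimate are at most eps / 2 *)
  pose N := (Num.bound (2 * a / (rate * eps))).+1.
  have a0 : 0 < a by exact: le_lt_trans J0a.
  have aN : 2 * a <= N%:R * (rate * eps).
    rewrite -ler_pdivrMr//.
    apply/ltW/(lt_le_trans (archi_boundP (ltW (divr_gt0 _ re0)))).
      by rewrite mulr_gt0.
    by rewrite ler_nat.
  exists (N.+1%:R * L); apply: filterS (e_near _ re0) => k ek.
  have [PF xL] := mkP k.
  have := ball_mass_compl_le mF F0 L0 J00 J0a F_far F_inf N PF (ltW (ek0 k)) xL.
  rewrite -/conc -/rate => h.
  have N0 : 0 < N%:R :> R by rewrite ltr0n.
  have {}h : 1 - eps <= ball_mass (mk k) (vertex R n) (N.+1%:R * L).
    rewrite lerBlDr -lerBlDl -(@ler_pM2l _ rate)// -(@ler_pM2l _ N%:R)//.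
    apply: (le_trans h).
    have : N%:R * (e k / 2) <= N%:R * (rate * eps / 2).
      by rewrite ler_pM2l// ler_pM2r.
    lra.
  apply: (@le_trans _ _ (mk k [set x | hdist x (vertex R n) < N.+1%:R * L])).
    by rewrite -(@fineK _ (mk k _)) ?fin_num_measure ?lee_fin//;
      exact: measurable_hdist_lt.
  apply: le_measure; rewrite ?inE; [exact: measurable_hdist_lt|exact: measurable_hdist_le|].
  by move=> x /= /ltW.
have UP : ProperFilter U by exact: ultra_proper.
have [m mU] := tight_weak_limit UU tight.
exists m; rewrite leNgt; apply/negP => J0m.
have [t J0t tm] : exists2 t : R, J0 < t & (t%:E < \int[m \x m]_p F p)%E.
  move: J0m; case: (\int[m \x m]_p F p)%E => [s| |]//.
    by rewrite lte_fin => J0s; exists ((J0 + s) / 2); rewrite ?lte_fin; lra.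
  by move=> _; exists (J0 + 1); [lra|exact: ltry].
have tJ0 : 0 < (t - J0) / 2 by rewrite divr_gt0// subr_gt0.
have [k [tk ek]] := filter_ex
  (filterI (le_liminf_integral2 mU F0 oF tm) (e_near _ tJ0)).
have := lt_le_trans tk (mkP k).1.
by rewrite lte_fin; move: ek => /=; lra.
Qed.


End minimization.

(** * Minimizers and their supports *)

Section support.
Variables (R : realType) (n : nat).
Implicit Types (P : probability (Hyp R n) R) (x : Hyp R n).

Lemma closed_msupport P : closed (msupport P).
Proof.
rewrite -[msupport P]setCK; apply: open_closedC; rewrite openE => x /= nx.
have [V [oV [Vx PV]]] : exists V, open V /\ V x /\ ~ (0 < P V)%E.
  apply: contrapT => h; apply: nx => V oV Vx; apply: contrapT => PV.
  by apply: h; exists V.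
rewrite /interior; apply: (@filterS _ _ _ V); last exact: open_nbhs_nbhs.
by move=> y Vy ny; apply: PV; exact: ny.
Qed.

Lemma msupport_ball P x (r : R) : P [set y | hdist y x < r] = 1%E ->
  msupport P `<=` [set y | hdist y x <= r].
Proof.
move=> P1 y Py; rewrite /= leNgt; apply/negP => ry.
have := Py _ (@open_hdist_gt R n x r) ry; apply/negP; rewrite -leNgt.
have -> : 0%E = P (~` [set y | hdist y x < r]).
  by rewrite probability_setC ?P1 ?subee//; exact: measurable_hdist_lt.
apply: le_measure; rewrite ?inE.
- by apply: open_measurable_hyp; exact: open_hdist_gt.
- by apply: measurableC; exact: measurable_hdist_lt.
- by move=> z /= rz; apply/negP; rewrite -leNgt ltW.
Qed.

Lemma compact_hball_center x (r : R) : compact [set y | hdist y x <= r].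
Proof.
apply: (subclosed_compact _ (@compact_hball R n (r + hdist x (vertex R n)))).
  have -> : [set y | hdist y x <= r] = ~` [set y | r < hdist y x].
    by apply/seteqP; split => y /=; rewrite leNgt => /negP.
  by apply: open_closedC; exact: open_hdist_gt.
move=> y /= yr; apply: le_trans (hdist_triangle y x _) _.
by rewrite lerD2r.
Qed.

End support.

Theorem theorem4p1 (R : realType) (n : nat) (K : R -> \bar R)
    (K_bounded_below : exists2 Kmin : R, Kmin < 0 &
       forall t : R, 0 <= t -> (Kmin%:E <= K t)%E)
    (K_locally_integrable : forall r : R, 0 < r ->
       (\int[@hvol R n]_(x in [set x | (hdist x (vertex R n) < r)%R])
          `|K (hdist x (vertex R n))| < +oo)%E)
    (K_unstable : exists2 Koo : \bar R, K t @[t --> +oo] --> Koo &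
       exists rho : probability (Hyp R n) R,
         (energy K rho < (2^-1)%:E * Koo)%E)
    (K_lsc : lower_semicontinuous (K : subspace `[0, +oo[ -> \bar R))
    (K_increasing : exists2 R6 : R, 0 < R6 &
       forall s t : R, R6 <= s -> s < t -> (K s < K t)%E) :
  (exists rho : probability (Hyp R n) R, minimizer K rho) /\
  (exists2 D : R, 0 < D &
     forall rho : probability (Hyp R n) R, minimizer K rho ->
       compact (msupport rho) /\ (hdiam (msupport rho) <= D%:E)%E).
Proof.
have [Kmin Kmin0 K_ge] := K_bounded_below.
pose F (p : Hyp R n * Hyp R n) : \bar R := (K (hdist p.1 p.2) - Kmin%:E)%E.
have F0 p : (0 <= F p)%E by rewrite sube_ge0// K_ge// hdist_ge0.
have oF (t : R) : open [set p | (t%:E < F p)%E].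
  rewrite openE => p /=; rewrite /F lteBrDr// -EFinD => tp.
  have [V + VK] := K_lsc (hdist p.1 p.2) _ tp.
  rewrite /nbhs/= -nbhs_subspace_in/= ?in_itv/= ?andbT ?hdist_ge0// => Vp.
  apply: (@filterS _ _ (nbhs_filter p) _ _ _ (continuous_hdist Vp)) => q /= Vq.
  by rewrite EFinN lteBrDr// -EFinD; apply/VK/Vq; rewrite in_itv/= andbT hdist_ge0.
have mF : measurable_fun setT F.
  by apply: measurable_fun_superlevel => t; exact: open_measurable_hyp2.
have F_dist x y x' y' : hdist x y = hdist x' y' -> F (x, y) = F (x', y').
  by rewrite /F /= => ->.
(* the energy is an increasing affine function of the integral of F *)
have energyE rho : energy K rho = ((2^-1)%:E * (\int[rho \x rho]_p F p + Kmin%:E))%E.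
  rewrite /energy (integralB_lower_bound _ (ltW Kmin0))//.
    have -> : (fun p : Hyp R n * Hyp R n => K (hdist p.1 p.2)) =
        (fun p => (F p + Kmin%:E)%E).
      by apply/funext => p; rewrite /F subeK.
    exact: emeasurable_funD.
  by move=> p; apply: K_ge; exact: hdist_ge0.
have energy_le rho nu : (energy K rho <= energy K nu)%E =
    (\int[rho \x rho]_p F p <= \int[nu \x nu]_p F p)%E.
  by rewrite !energyE lee_pmul2l// leeD2rE.
pose J : \bar R := ereal_inf
  [set (\int[Q \x Q]_p F p)%E | Q in [set: probability (Hyp R n) R]].
have J_le (Q : probability (Hyp R n) R) : (J <= \int[Q \x Q]_p F p)%E.
  by apply: ereal_inf_lbound; exists Q.
have J_ge0 : (0 <= J)%E.
  by apply: le_ereal_inf_tmp => _ [Q _ <-]; exact: integral_ge0.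
have [Koo K_cvg [rho0 rho0E]] := K_unstable.
(* a level a strictly between the infimum of the integral of F and its value
   at infinity *)
have [a Ja aKoo] : exists2 a : R, (J < a%:E)%E & ((a + Kmin)%:E < Koo)%E.
  move: rho0E; rewrite energyE lte_pmul2l//.
  have := J_le rho0; have := integral_ge0 (rho0 \x rho0)%E (fun p _ => F0 p).
  case: (\int[rho0 \x rho0]_p F p)%E => [s| |]// _.
  case: Koo {K_cvg} => [k| |]// Js; rewrite -EFinD ?lte_fin => sk.
      exists ((s + (k - Kmin)) / 2); rewrite ?lte_fin; last lra.
    by apply: le_lt_trans Js _; rewrite lte_fin; lra.
    exists (s + 1); last exact: ltry.
    by apply: le_lt_trans Js _; rewrite lte_fin; lra.
    by move=> _; rewrite addye// ltNge leey.
  by move=> /(le_trans J_ge0).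
have [L L0 KL] : exists2 L : R, 0 < L & forall t, L <= t -> ((a + Kmin)%:E < K t)%E.
  have : \forall t \near +oo, ((a + Kmin)%:E < K t)%E.
    by apply: (K_cvg [set y | ((a + Kmin)%:E < y)%E]); exact: open_ereal_gt'.
  (* M + 1 because the neighborhood is given by a strict inequality *)
  move=> [M [_ KM]]; exists (Num.max 1 (M + 1)).
    by rewrite lt_max ltr01.
  by move=> t; rewrite ge_max => /andP[_ Mt]; apply: KM; lra.
have F_far x y : L <= hdist x y -> (a%:E <= F (x, y))%E.
  by move=> /KL /ltW h; rewrite /F leeBrDr// -EFinD; exact: h.
have Jfin : J \is a fin_num by rewrite ge0_fin_numE// (lt_trans Ja) ?ltry.
pose J0 := fine J; have JE : J = J0%:E by rewrite fineK.
have J00 : 0 <= J0 by rewrite fine_ge0.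
have J0a : J0 < a by rewrite -lte_fin -JE.
have F_inf (Q : probability (Hyp R n) R) : (J0%:E <= \int[Q \x Q]_p F p)%E by rewrite -JE.
split.
  have [||m mJ0] := exists_minimum F0 oF L0 J00 J0a F_far F_inf.
  - exact: F_dist.
  - move=> e e0; have [_ [Q _ <-] Qe] := lb_ereal_inf_adherent e0 Jfin.
    by exists Q; rewrite EFinD -JE ltW.
  by exists m => nu; rewrite energy_le (le_trans mJ0).
pose rate := (a - J0) * concentration a J0.
have rate0 : 0 < rate by rewrite mulr_gt0 ?subr_gt0 ?concentration_gt0.
have a0 : 0 < a by exact: le_lt_trans J0a.
pose N := Num.bound (a / rate).
have aN : a < N%:R * rate.
  by rewrite -ltr_pdivrMr// archi_boundP// divr_ge0// ltW.
pose r := N.+1%:R * L; have r0 : 0 < r by rewrite mulr_gt0.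
exists (r + r); first by rewrite addr_gt0.
move=> rho rho_min.
have rhoJ : (\int[rho \x rho]_p F p <= J0%:E)%E.
  by rewrite -JE; apply: le_ereal_inf_tmp => _ [Q _ <-]; rewrite -energy_le.
have rhoJe : (\int[rho \x rho]_p F p <= (J0 + 0)%:E)%E by rewrite addr0.
have aJ0 : 0 < (a - J0) / 2 by rewrite divr_gt0// subr_gt0.
have [x xL] := exists_center mF F0 J00 J0a F_far aJ0 rhoJe.
have x1 : rho [set y | hdist y x < r] = 1%E.
  rewrite ball_massE.
  by rewrite (ball_mass_eq1 mF F0 L0 J00 J0a F_far F_inf rhoJ xL aN).
have supp := msupport_ball x1; split.
  apply: (subclosed_compact _ (@compact_hball_center R n x r)) => //.
  exact: closed_msupport.
apply: ge_ereal_sup => _ [[y z] [/= /supp yr /supp zr] <-].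
rewrite lee_fin; apply: le_trans (hdist_triangle y x z) _.
by apply: lerD => //; rewrite hdistC.
Qed.
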